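(* Fix $\beta>0$, $q\in\mathbb{N}$ and $\boldsymbol{B}=(B_1,\dots,B_q)$ with $B_k\ge 0$ for all $k$. Consider the annealed $q$-state Potts model on the rank-1 (generalized) random graph with weights satisfying the weight regularity condition (all defined in the context), and let $\varphi_n(\beta,\boldsymbol{B})=\frac1n\log\mathbb{E}[Z_n(\beta,\boldsymbol{B})]$ be its annealed pressure per particle. Then $\varphi(\beta,\boldsymbol{B}):=\lim_{n\to\infty}\varphi_n(\beta,\boldsymbol{B})$ exists and $$\varphi(\beta,\boldsymbol{B})=\sup_{\boldsymbol{y}\in\mathbb{R}^q}\Big[F_{\beta,\boldsymbol{B}}(\boldsymbol{y})-\frac{\beta'}{2\,\mathbb{E}[W]}\sum_{k=1}^q y_k^2\Big],$$ where $\beta'=\mathrm{e}^{\beta}-1$ and $$F_{\beta,\boldsymbol{B}}(\boldsymbol{y})=\mathbb{E}\Big[\log\Big(\mathrm{e}^{\frac{\beta'}{\mathbb{E}[W]}y_1W+B_1}+\cdots+\mathrm{e}^{\frac{\beta'}{\mathbb{E}[W]}y_qW+B_q}\Big)\Big].$$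
   Context: Random graph: for each $n$, the vertex set is $[n]=\{1,\dots,n\}$, each vertex $i\in[n]$ has a deterministic weight $w_i>0$ (possibly depending on $n$), and $\ell_n=\sum_{i\in[n]}w_i$. The edge indicators $(I_{i,j})_{1\le i<j\le n}$ are independent with $\mathbb{P}(I_{i,j}=1)=\frac{w_iw_j}{\ell_n+w_iw_j}$. Weight regularity condition: let $F_n(x)=\frac1n\sum_{i\in[n]}\mathbf{1}_{\{w_i\le x\}}$ be the empirical weight distribution and let $W_n$ be a random variable with distribution function $F_n$. There is a random variable $W$ with $\mathbb{E}[W]>0$ such that (a) $W_n\to W$ in distribution as $n\to\infty$; (b) there exist $c>0$ and $\tau>2$ such that $1-F_n(w)\le c\,w^{-(\tau-1)}$ for all $w\ge1$ (and all $n$). (This implies $\mathbb{E}[W_n]\to\mathbb{E}[W]<\infty$.) Annealed partition function: with $[q]=\{1,\dots,q\}$, $$Z_n(\beta,\boldsymbol{B})=\sum_{\boldsymbol{\sigma}\in[q]^n}\exp\Big[\beta\sum_{1\le i<j\le n}I_{i,j}\mathbf{1}_{\{\sigma_i=\sigma_j\}}+\sum_{i\in[n]}\sum_{k\in[q]}B_k\mathbf{1}_{\{\sigma_i=k\}}\Big],$$ and $\mathbb{E}[Z_n(\beta,\boldsymbol{B})]$ is its expectation over the random graph. *)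

(* Defs.v *)
From HB Require Import structures.
From mathcomp Require Import all_boot all_order all_algebra.
From mathcomp Require Import all_classical all_reals all_analysis.

Set Implicit Arguments.
Unset Strict Implicit.
Unset Printing Implicit Defensive.

Import Order.TTheory GRing.Theory Num.Theory.
Import numFieldNormedType.Exports.

Local Open Scope classical_set_scope.
Local Open Scope ring_scope.

(* Mutual independence, under [P], of the random variables [X j] for [j \in D].
   As [D] is finite, every finite subfamily is some [S \subset D]. *)
Definition mutually_independent (R : realType) (d d' : measure_display)
    (T : measurableType d) (T' : measurableType d') (P : probability T R)
    (J : finType) (D : {set J}) (X : J -> {RV P >-> T'}) : Prop :=
  forall (S : {set J}) (A : J -> set T'), S \subset D ->
    (forall j, j \in S -> measurable (A j)) ->
    P (\bigcap_(j in [set j | j \in S]) (X j @^-1` A j)) =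
    (\prod_(j in S) P (X j @^-1` A j))%E.

Definition total_weight (R : realType) (n : nat) (w : 'I_n -> R) : R :=
  \sum_(i < n) w i.

(* Only the indicators [I i j] with [i < j] are edges; the values of [I]
   on the other pairs are irrelevant. *)
Definition generalized_random_graph (R : realType) (d : measure_display)
    (T : measurableType d) (P : probability T R) (n : nat) (w : 'I_n -> R)
    (I : 'I_n -> 'I_n -> {RV P >-> bool}) : Prop :=
  mutually_independent [set p : 'I_n * 'I_n | (p.1 < p.2)%N]%SET
    (fun p => I p.1 p.2) /\
  forall i j : 'I_n, (i < j)%N ->
    P (I i j @^-1` [set true]) =
    (w i * w j / (total_weight w + w i * w j))%:E.

Definition empirical_cdf (R : realType) (n : nat) (w : 'I_n -> R) (x : R) : R :=
  (\sum_(i < n) (w i <= x)%R%:R) / n%:R.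

(* Convergence in distribution of laws given by their distribution functions
   [F n] to the law of [W]. *)
Definition cvg_in_distribution (R : realType) (d : measure_display)
    (T : measurableType d) (P : probability T R)
    (F : nat -> R -> R) (W : {RV P >-> R}) : Prop :=
  forall x : R, {for x, continuous (cdf W)} ->
    (F n x)%:E @[n --> \oo] --> cdf W x.

(* The tail bound is required for n >= 1 only: for n = 0 there are no vertices
   and [empirical_cdf] is the junk value 0. *)
Definition weight_regularity (R : realType) (d : measure_display)
    (T : measurableType d) (P : probability T R)
    (w : forall n, 'I_n -> R) (W : {RV P >-> R}) : Prop :=
  [/\ (0 < 'E_P[W])%E,
      cvg_in_distribution (fun n => empirical_cdf (w n)) W &
      exists c tau : R, [/\ 0 < c, 2 < tau &
        forall (n : nat) (x : R), (0 < n)%N -> 1 <= x ->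
          1 - empirical_cdf (w n) x <= c * x `^ (- (tau - 1))]].

Definition partition_function (R : realType) (n q : nat) (beta : R)
    (B : 'rV[R]_q) (I : 'I_n -> 'I_n -> bool) : R :=
  \sum_(sigma : {ffun 'I_n -> 'I_q})
    expR (beta * (\sum_(i < n) \sum_(j < n | (i < j)%N)
                    (I i j)%:R * (sigma i == sigma j)%:R)
          + \sum_(i < n) \sum_(k < q) B ord0 k * (sigma i == k)%:R).

Definition annealed_pressure (R : realType) (d : measure_display)
    (T : measurableType d) (P : probability T R) (n q : nat) (beta : R)
    (B : 'rV[R]_q) (I : 'I_n -> 'I_n -> {RV P >-> bool}) : R :=
  n%:R^-1 *
  ln (fine 'E_P[fun t => partition_function beta B (fun i j => I i j t)]).

Definition beta' (R : realType) (beta : R) : R := expR beta - 1.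

Definition mean (R : realType) (d : measure_display) (T : measurableType d)
    (P : probability T R) (W : {RV P >-> R}) : R := fine 'E_P[W].

Definition F_potts (R : realType) (d : measure_display) (T : measurableType d)
    (P : probability T R) (W : {RV P >-> R}) (q : nat) (beta : R)
    (B y : 'rV[R]_q) : \bar R :=
  'E_P[fun t => ln (\sum_(k < q)
     expR (beta' beta / mean W * y ord0 k * W t + B ord0 k))].

(* Main.v *)
(* Averaging over the independent edges gives
   E Z_n = sum_sigma e^{B(sigma)} prod_{i<j} (1 + b p_ij 1{sigma_i = sigma_j}),
   b = e^beta - 1. Uniform integrability of the weights, which follows from the
   tail bound, allows to replace each factor by
   exp(b w_i w_j / l_n 1{sigma_i = sigma_j}) and to add the diagonal terms, at
   a cost e^{o(n)} that is uniform in sigma. The exponent becomes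
   b / (2 l_n) sum_k S_k^2 + B(sigma), where S_k is the total weight of the
   vertices of spin k. Instead of a Gaussian (Hubbard-Stratonovich) integral,
   squares are linearized by S^2 = 2 S z - z^2 + (S - z)^2: dropping the last
   square bounds the partition function from below for every z, and letting z
   range over a grid of mesh l_n / N, whose size does not depend on n, bounds it
   from above. For fixed z the linearized sum factorizes over the vertices, so
   only the convergence of the averages of f(w_i) to E[f(W)] is needed, for
   Lipschitz f. *)

Require Import Defs.
From HB Require Import structures.
From mathcomp Require Import all_boot all_order all_algebra.
From mathcomp Require Import all_classical all_reals all_analysis.
From mathcomp Require Import measurable_realfun.
From mathcomp Require Import ring lra.

Set Implicit Arguments.
Unset Strict Implicit.
Unset Printing Implicit Defensive.

Import Order.TTheory GRing.Theory Num.Theory.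
Import numFieldNormedType.Exports.

Local Open Scope classical_set_scope.
Local Open Scope ring_scope.

(** * Expectation of products over independent edges *)

Lemma expectation_sum_indic (R : realType) (d : measure_display)
    (T : measurableType d) (P : probability T R) (J : finType)
    (a p : J -> R) (A : J -> set T) :
    (forall j, measurable (A j)) -> (forall j, P (A j) = (p j)%:E) ->
  'E_P[(fun t => \sum_j a j * \1_(A j) t)%R]%E = (\sum_j a j * p j)%:E.
Proof.
move=> mA PA; rewrite unlock.
under eq_integral do rewrite -sumEFin.
rewrite integral_sum//; last first.
  move=> j; under [X in _.-integrable _ X]funext do rewrite EFinM.
  by apply: integrableZl => //; exact: integrable_indic.
rewrite -sumEFin; apply: eq_bigr => j _.
under eq_integral do rewrite EFinM.
rewrite integralZl//; last exact: integrable_indic.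
rewrite integral_indic//= setIT EFinM.  congr (_ * _)%E; exact: PA.
Qed.

Lemma prod_1D (R : comPzRingType) (J : finType) (D : {set J}) (x : J -> R) :
  \prod_(j in D) (1 + x j)
  = \sum_(S : {set J}) (S \subset D)%:R * \prod_(j in S) x j.
Proof.
transitivity (\prod_j ((if j \in D then x j else 0) + 1)).
  rewrite big_mkcond/=; apply: eq_bigr => j _.
  by case: ifP => _; rewrite ?add0r// addrC.
rewrite bigA_distr; apply: eq_bigr => S _.
rewrite -big_mkcond/=; case: (boolP (S \subset D)) => [SD|].
  by rewrite mul1r; apply: eq_bigr => j jS; rewrite (fintype.subsetP SD).
move=> /fintype.subsetPn[j jS jD]; rewrite mul0r.
by rewrite (bigD1 j)//= (negbTE jD) mul0r.
Qed.

(** Independence speaks of intersections of events, so the product is expanded over subsets of [D]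
    by [prod_1D]. The product of the [X j] over a subset [S] is the indicator of the event that all
    edges of [S] are present. *)
Lemma expectation_sum_prod_indep (R : realType) (d : measure_display)
    (T : measurableType d) (P : probability T R) (J K : finType)
    (D : {set J}) (X : J -> {RV P >-> bool}) (p : J -> R)
    (a : K -> R) (c : K -> J -> R) :
    mutually_independent D X ->
    (forall j, j \in D -> P (X j @^-1` [set true]) = (p j)%:E) ->
  'E_P[(fun t => \sum_k a k * \prod_(j in D) (1 + c k j * (X j t)%:R))%R]%E
   = (\sum_k a k * \prod_(j in D) (1 + c k j * p j))%:E.
Proof.
move=> indX Xp.
(* The event that all edges of [S] are present. It is made empty for [S] not inside [D], matching
   the zero coefficient of such [S] in [prod_1D]. *)
pose A (S : {set J}) : set T :=
  if S \subset D then \bigcap_(j in [set j | j \in S]) (X j @^-1` [set true])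
  else set0.
pose m (S : {set J}) := (S \subset D)%:R * \prod_(j in S) p j.
pose e (S : {set J}) := \sum_k a k * \prod_(j in S) c k j.
have mX j : measurable (X j @^-1` [set true]).
  by rewrite -[X in measurable X]setTI; exact: measurable_funP.
have mA S : measurable (A S).
  rewrite /A; case: ifP => // _.
  apply: fin_bigcap_measurable => [|j _]; [exact: finite_finset|exact: mX].
have PA S : P (A S) = (m S)%:E.
  rewrite /A /m; case: ifPn => SD; last by rewrite measure0 mul0r.
  rewrite (indX S (fun=> [set true]))// mul1r.
  rewrite -prodEFin; apply: eq_bigr => j jS.
  by rewrite Xp// (fintype.subsetP SD).
have := expectation_sum_indic e mA PA; set f := (X in 'E_P[X]%E).
set g := (X in _ -> 'E_P[X]%E = _).
have -> : f = g.
  apply/funext => t; rewrite /f /g.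
  under [RHS]eq_bigr do rewrite prod_1D mulr_sumr.
  rewrite [RHS]exchange_big/=; apply: eq_bigr => S _.
  rewrite /e mulr_suml; apply: eq_bigr => k _.
  rewrite -mulrA; congr (_ * _).
  rewrite big_split/= mulrCA; congr (_ * _).
  rewrite indicE /A; case: ifPn => SD; last by rewrite in_set0 mul0r.
  rewrite mul1r; case: (boolP (t \in _)) => [|/negP].
    rewrite inE => /= h; rewrite big1// => j jS.
    by have -> := h j jS.
  move=> h; have /existsNP[j hj] : ~ forall j, j \in S -> X j t.
    by move=> h'; apply: h; rewrite inE => j /h'.
  have [jS Xj] : j \in S /\ ~~ X j t.
    by split; [|apply/negP => ?]; apply: contrapT => ?; apply: hj.
  by rewrite (bigD1 j)//= (negbTE Xj) mul0r.
move=> ->; congr (_%:E).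
under [RHS]eq_bigr do rewrite prod_1D mulr_sumr.
rewrite [RHS]exchange_big/=; apply: eq_bigr => S _.
rewrite /e mulr_suml; apply: eq_bigr => k _.
by rewrite -mulrA; congr (_ * _); rewrite big_split/= /m mulrCA.
Qed.

Lemma sum_field (R : realType) (n q : nat) (B : 'rV[R]_q)
    (sigma : {ffun 'I_n -> 'I_q}) :
  \sum_(i < n) \sum_(k < q) B ord0 k * (sigma i == k)%:R
  = \sum_(i < n) B ord0 (sigma i).
Proof.
apply: eq_bigr => i _; rewrite (bigD1 (sigma i))//= eqxx mulr1 big1 ?addr0//.
by move=> k; rewrite eq_sym => /negbTE ->; rewrite mulr0.
Qed.

Lemma sum_ltn_pair (R : nmodType) (n : nat) (f : 'I_n -> 'I_n -> R) :
  \sum_(i < n) \sum_(j < n | (i < j)%N) f i j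
  = \sum_(p in [set p : 'I_n * 'I_n | (p.1 < p.2)%N]%SET) f p.1 p.2.
Proof. by rewrite pair_big_dep/=; apply: eq_bigl => p; rewrite inE. Qed.

Definition edge_prob {R : realType} {n : nat} (w : 'I_n -> R) (i j : 'I_n) :
    R :=
  w i * w j / (total_weight w + w i * w j).

Definition expected_partition {R : realType} {n q : nat} (b : R)
    (B : 'rV[R]_q) (w : 'I_n -> R) : R :=
  \sum_(sigma : {ffun 'I_n -> 'I_q}) expR (\sum_(i < n) B ord0 (sigma i)) *
     \prod_(p in [set p : 'I_n * 'I_n | (p.1 < p.2)%N]%SET)
       (1 + b * (sigma p.1 == sigma p.2)%:R * edge_prob w p.1 p.2).

Lemma expected_partition_function (R : realType) (d : measure_display)
    (T : measurableType d) (P : probability T R) (n q : nat) (beta : R)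
    (B : 'rV[R]_q) (w : 'I_n -> R) (I : 'I_n -> 'I_n -> {RV P >-> bool}) :
    generalized_random_graph w I ->
  'E_P[fun t => partition_function beta B (fun i j => I i j t)]%E =
  (expected_partition (beta' beta) B w)%:E.
Proof.
move=> [indI Ip]; rewrite /expected_partition.
rewrite -(expectation_sum_prod_indep
  (fun sigma : {ffun 'I_n -> 'I_q} => expR (\sum_(i < n) B ord0 (sigma i)))
  (fun sigma p => beta' beta * (sigma p.1 == sigma p.2)%:R) indI); last first.
  by move=> p; rewrite inE => /Ip ->.
congr ('E_P[_])%E; apply/funext => t; rewrite /partition_function.
apply: eq_bigr => sigma _; rewrite sum_field addrC expRD; congr (_ * _).
rewrite sum_ltn_pair mulr_sumr expR_sum; apply: eq_bigr => p _.
(* For [u] equal to 0 or 1, e^{beta u} = 1 + (e^beta - 1) u. *)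
by rewrite /beta'; case: (I p.1 p.2 t) => /=; case: (_ == _) => /=;
  rewrite ?(mulr1, mulr0, mul0r, mul1r, addr0, expR0)// addrC subrK.
Qed.

(** * Mean-field bounds on the expected partition function *)

Definition spin_weight {R : realType} {n q : nat} (w : 'I_n -> R)
  (sigma : {ffun 'I_n -> 'I_q}) (k : 'I_q) : R :=
  \sum_(i < n) w i * (sigma i == k)%:R.

(** The Potts model on the complete graph with coupling b w_i w_j / l between [i] and [j], each
    diagonal term contributing half of b w_i^2 / l (see [sum_spin_weight_sqr]). *)
Definition mean_field_partition_function {R : realType} {n q : nat} (b : R)
    (B : 'rV[R]_q) (w : 'I_n -> R) : R :=
  \sum_(sigma : {ffun 'I_n -> 'I_q})
    expR (b / (2 * total_weight w) * \sum_(k < q) spin_weight w sigma k ^+ 2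
          + \sum_(i < n) B ord0 (sigma i)).

Lemma sum_spin_weightM (R : realType) (n q : nat) (w : 'I_n -> R)
    (sigma : {ffun 'I_n -> 'I_q}) (a : 'I_q -> R) :
  \sum_(k < q) a k * spin_weight w sigma k = \sum_(i < n) a (sigma i) * w i.
Proof.
under eq_bigr do rewrite mulr_sumr.
rewrite exchange_big/=; apply: eq_bigr => i _.
rewrite (bigD1 (sigma i))//= eqxx mulr1 big1 ?addr0// => k.
by rewrite eq_sym => /negbTE ->; rewrite !mulr0.
Qed.

Lemma sum_spin_weight_sqr (R : realType) (n q : nat) (w : 'I_n -> R)
    (sigma : {ffun 'I_n -> 'I_q}) :
  \sum_(k < q) spin_weight w sigma k ^+ 2
  = \sum_(i < n) \sum_(j < n) (sigma i == sigma j)%:R * (w i * w j).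
Proof.
under eq_bigr do rewrite expr2.
rewrite sum_spin_weightM; apply: eq_bigr => i _.
rewrite /spin_weight mulr_suml; apply: eq_bigr => j _.
by rewrite eq_sym mulrC [RHS]mulrCA; congr (_ * _); rewrite mulrC.
Qed.

Lemma spin_weight_itv (R : realType) (n q : nat) (w : 'I_n -> R)
    (sigma : {ffun 'I_n -> 'I_q}) (k : 'I_q) : (forall i, 0 <= w i) ->
  0 <= spin_weight w sigma k <= total_weight w.
Proof.
move=> w0; rewrite sumr_ge0 => [|i _]; last by rewrite mulr_ge0.
by apply: ler_sum => i _; rewrite ler_piMr// lern1 leq_b1.
Qed.

Lemma sum_ltn_sym (R : realType) (n : nat) (f : 'I_n -> 'I_n -> R) :
  (forall i j, f i j = f j i) ->
  \sum_(p in [set p : 'I_n * 'I_n | (p.1 < p.2)%N]%SET) f p.1 p.2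
  = (\sum_(i < n) \sum_(j < n) f i j - \sum_(i < n) f i i) / 2.
Proof.
move=> fC; rewrite -sum_ltn_pair.
have -> : \sum_(i < n) \sum_(j < n) f i j =
    \sum_(i < n) \sum_(j < n | (i < j)%N) f i j + \sum_(i < n) f i i
    + \sum_(i < n) \sum_(j < n | (j < i)%N) f i j.
  rewrite -!big_split/=; apply: eq_bigr => i _.
  rewrite (bigID (fun j : 'I_n => (i < j)%N))/= -addrA; congr (_ + _).
  rewrite (bigD1 i) ?ltnn//=; congr (_ + _); apply: eq_bigl => j.
  by rewrite -leqNgt [RHS]ltn_neqAle andbC.
suff -> : \sum_(i < n) \sum_(j < n | (j < i)%N) f i j
    = \sum_(i < n) \sum_(j < n | (i < j)%N) f i j by lra.
rewrite (exchange_big_dep xpredT)//=; apply: eq_bigr => i _.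
by apply: eq_bigr => j _; rewrite fC.
Qed.

Lemma total_weight_gt0 (R : realType) (n : nat) (w : 'I_n -> R) :
  (0 < n)%N -> (forall i, 0 < w i) -> 0 < total_weight w.
Proof.
case: n w => // n w _ w0; rewrite /total_weight big_ord_recl.
by rewrite ltr_pwDl// sumr_ge0// => i _; exact: ltW.
Qed.

(** * Exponential bounds on a single edge factor *)

Section edge_factor.
Context {R : realType}.
Implicit Types b c x eps : R.

(** Rests on 1 + u <= e^u and x / (1 + x) <= x. With x = w_i w_j / l, the quotient x / (1 + x) is
    the edge probability. *)
Lemma edge_factor_le c x : 0 <= c -> 0 <= x ->
  1 + c * (x / (1 + x)) <= expR (c * x).
Proof.
move=> c0 x0; apply: le_trans (expR_ge1Dx _); rewrite lerD2l ler_wpM2l//.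
by rewrite ler_pdivrMr ?ler_peMr// ?lerDl//; lra.
Qed.

(* Rests on [1 + u >= exp (u / (1 + u))] with [u = c x / (1 + x)]. *)
Lemma edge_factor_ge b c x eps : 0 <= c -> c <= b -> 0 <= x -> 0 < eps ->
  expR (c * x - (b * (1 + b) * eps * x + b * (x * (eps < x)%R%:R)))
  <= 1 + c * (x / (1 + x)).
Proof.
move=> c0 cb x0 e0.
set u := c * (x / (1 + x)).
have x1 : 0 < 1 + x by lra.
have cx0 : 0 <= c * x by rewrite mulr_ge0.
have u0 : 0 <= u by rewrite /u mulrA divr_ge0// ltW.
have u1 : 0 < 1 + u by lra.
have {}u1 : expR (u / (1 + u)) <= 1 + u.
  rewrite -[leRHS]invrK -[leLHS]invrK lef_pV2 ?posrE ?invr_gt0 ?expR_gt0//.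
  rewrite -expRN; apply: le_trans (expR_ge1Dx _).
  by rewrite le_eqVlt; apply/orP; left; apply/eqP; field; rewrite gt_eqF.
apply: le_trans u1; rewrite ler_expR.
have c1 : 0 < 1 + (1 + c) * x by rewrite ltr_wpDr// mulr_ge0//; lra.
have -> : u / (1 + u) = c * x - c * x * ((1 + c) * x / (1 + (1 + c) * x)).
  by rewrite /u; field; rewrite !gt_eqF//; move: c1; lra.
rewrite lerD2l lerN2.
set v := (1 + c) * x; rewrite -/v in c1.
have v0 : 0 <= v by rewrite mulr_ge0//; lra.
(* The loss is c x v / (1 + v). For x > eps it is bounded by c x <= b x; for x <= eps it is at most
   c x v, where v <= (1 + b) eps. *)
have b0 : 0 <= b by exact: le_trans cb.
case: (ltP eps x) => xe /=.
  rewrite mulr1 ler_wpDl ?mulr_ge0//; try lra.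
  rewrite (le_trans _ (ler_wpM2r x0 cb))// ler_piMr//.
  by rewrite ler_pdivrMr// mul1r; lra.
rewrite !mulr0 addr0.
apply: (@le_trans _ _ (c * x * v)).
  rewrite ler_wpM2l// ler_pdivrMr// ler_peMr//; lra.
have : c * x * v <= b * x * ((1 + b) * eps).
  rewrite ler_pM ?ler_wpM2r//.
  by rewrite /v ler_pM//; lra.
by move/le_trans; apply; rewrite le_eqVlt; apply/orP; left; apply/eqP; ring.
Qed.

End edge_factor.

Definition tail_weight {R : realType} {n : nat} (w : 'I_n -> R) (M : R) : R :=
  \sum_(i < n) w i * (M < w i)%R%:R.

Definition log_sum_exp {R : realType} {q : nat} (a : R) (B y : 'rV[R]_q)
    (x : R) : R :=
  ln (\sum_(k < q) expR (a * y ord0 k * x + B ord0 k)).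

(** Logarithm of the mean-field sum after S_k^2 is replaced by 2 S_k z_k - z_k^2 with z_k = l y_k /
    m. The sum over spins then factorizes, which leaves one [log_sum_exp] per vertex. *)
Definition linearized_exponent {R : realType} {n q : nat} (b m : R)
    (B : 'rV[R]_q) (w : 'I_n -> R) (y : 'rV[R]_q) : R :=
  \sum_(i < n) log_sum_exp (b / m) B y (w i)
  - b / (2 * m ^+ 2) * total_weight w * \sum_(k < q) y ord0 k ^+ 2.

Lemma sum_expR_gt0 (R : realType) (q : nat) (f : 'I_q -> R) :
  (0 < q)%N -> 0 < \sum_(k < q) expR (f k).
Proof.
case: q f => // q f _; rewrite big_ord_recl ltr_pwDl ?expR_gt0//.
by rewrite sumr_ge0// => k _; exact: expR_ge0.
Qed.

Section mean_field_bounds.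
Context {R : realType} {n q : nat} (b : R) (B : 'rV[R]_q) (w : 'I_n -> R).
Hypotheses (n_gt0 : (0 < n)%N) (w_gt0 : forall i, 0 < w i) (b_ge0 : 0 <= b).

Let l := total_weight w.
Let l_gt0 : 0 < l. Proof. exact: total_weight_gt0. Qed.
Let x i j := w i * w j / l.
Let x_ge0 i j : 0 <= x i j.
Proof. by rewrite divr_ge0 ?mulr_ge0// ltW. Qed.

Let edge_probE i j : edge_prob w i j = x i j / (1 + x i j).
Proof.
rewrite /edge_prob -/l /x; field; rewrite !gt_eqF//= ltr_wpDr//.
by rewrite mulr_ge0// ltW.
Qed.

Let sum_x : \sum_(i < n) \sum_(j < n) x i j = l.
Proof.
under eq_bigr do rewrite -mulr_suml -mulr_sumr.
rewrite -!mulr_suml -/l -[\sum_i w i]/l; field; exact: lt0r_neq0.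
Qed.

Let sum_edges (sigma : {ffun 'I_n -> 'I_q}) :
  \sum_(p in [set p : 'I_n * 'I_n | (p.1 < p.2)%N]%SET)
     b * (sigma p.1 == sigma p.2)%:R * x p.1 p.2
  = b / (2 * l) * \sum_(k < q) spin_weight w sigma k ^+ 2
    - b / 2 * \sum_(i < n) x i i.
Proof.
rewrite (sum_ltn_sym (f := fun i j => b * (sigma i == sigma j)%:R * x i j)); last first.
  by move=> i j; rewrite eq_sym /x [w i * _]mulrC.
rewrite sum_spin_weight_sqr mulrBl; congr (_ - _).
  rewrite mulr_suml mulr_sumr; apply: eq_bigr => i _.
  rewrite mulr_suml mulr_sumr; apply: eq_bigr => j _.
  by rewrite /x; field; exact: lt0r_neq0.
rewrite mulr_suml mulr_sumr; apply: eq_bigr => i _.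
by rewrite eqxx mulr1 mulrAC.
Qed.

(** Once each edge factor is bounded by an exponential, the two exponents differ only by the
    diagonal terms, which are nonnegative and present only on the mean-field side. *)
Lemma expected_partition_le :
  expected_partition b B w <= mean_field_partition_function b B w.
Proof.
apply: ler_sum => sigma _; rewrite addrC expRD ler_wpM2l ?expR_ge0//.
apply: (@le_trans _ _ (expR (\sum_(p in [set p : 'I_n * 'I_n | (p.1 < p.2)%N]%SET)
     b * (sigma p.1 == sigma p.2)%:R * x p.1 p.2))).
  rewrite expR_sum; apply: ler_prod => p _; rewrite edge_probE.
  apply/andP; split; last by apply: edge_factor_le => //; rewrite mulr_ge0.
  have : 0 <= x p.1 p.2 / (1 + x p.1 p.2) by rewrite divr_ge0// addr_ge0.
  by move=> h; rewrite addr_ge0// mulr_ge0// mulr_ge0.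
rewrite ler_expR sum_edges gerBl// mulr_ge0 ?divr_ge0// sumr_ge0//.
Qed.

(* [x i j > eps] forces [w i] or [w j] to exceed [sqrt (eps * l)], hence [M]. *)
Let sum_large_x (M eps : R) : 0 <= M -> M ^+ 2 <= eps * l ->
  \sum_(i < n) \sum_(j < n) x i j * (eps < x i j)%R%:R <= 2 * tail_weight w M.
Proof.
move=> M0 Ml.
apply: (@le_trans _ _ (\sum_(i < n) \sum_(j < n)
   (w i * (M < w i)%R%:R * (w j / l) + w i / l * (w j * (M < w j)%R%:R)))).
  apply: ler_sum => i _; apply: ler_sum => j _.
  case: ltP => /= ex; last first.
    by rewrite mulr0 addr_ge0// !mulr_ge0// ?invr_ge0 ltW.
  have [wi|wi] := ltP M (w i).
    have h : 0 <= w i / l * (w j * (M < w j)%R%:R).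
      by rewrite !mulr_ge0// ?invr_ge0 ltW.
    by rewrite /= !mulr1 {1}/x -[w i * w j / l]mulrA lerDl.
  have [wj|wj] := ltP M (w j).
    by rewrite /= !(mulr1, mulr0, mul0r, add0r)// /x mulrAC.
  exfalso; move: ex; apply/negP; rewrite -leNgt ler_pdivrMr//.
  by apply: le_trans Ml; rewrite expr2 ler_pM// ltW.
rewrite le_eqVlt; apply/orP; left; apply/eqP.
under eq_bigr do rewrite big_split/= -mulr_sumr -mulr_sumr -mulr_suml.
rewrite big_split/= -!mulr_suml -[\sum_i w i]/l -/(tail_weight w M).
by field; exact: lt0r_neq0.
Qed.

(** Since x_ii = w_i (w_i / l) and w_i <= l, a vertex heavier than [M] contributes at most w_i. Any
    other contributes at most M w_i / l, and these terms add up to at most [M]. *)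
Let sum_diag_x (M : R) : 0 <= M -> \sum_(i < n) x i i <= M + tail_weight w M.
Proof.
move=> M0.
have -> : M + tail_weight w M = \sum_(i < n) (M / l) * w i + tail_weight w M.
  by congr (_ + _); rewrite -mulr_sumr -[\sum_i w i]/l divfK// lt0r_neq0.
rewrite -big_split/=; apply: ler_sum => i _; rewrite /x.
have wl : w i / l <= 1.
  rewrite ler_pdivrMr// mul1r /l /total_weight (bigD1 i)//= lerDl.
  by rewrite sumr_ge0// => j _; exact: ltW.
have wi0 := ltW (w_gt0 i); case: ltP => Mw /=.
  rewrite mulr1 ler_wpDl//; last by rewrite -mulrA ler_piMr.
  by rewrite mulr_ge0// divr_ge0// ltW.
have li : 0 <= l^-1 by rewrite invr_ge0 ltW.
by rewrite mulr0 addr0 mulrAC ler_wpM2r// ler_wpM2r.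
Qed.

(** Three losses, none depending on sigma: b (1 + b) eps l from the replacement of edge factors, 2 b
    times the tail weight from the pairs with x_ij > eps, and b/2 times M plus the tail weight from
    the diagonal. The constants are rounded up. *)
Lemma expected_partition_ge (M eps : R) : 0 <= M -> 0 < eps -> M ^+ 2 <= eps * l ->
  expR (- (b * (1 + b) * eps * l + 3 * b * tail_weight w M + b * M))
    * mean_field_partition_function b B w <= expected_partition b B w.
Proof.
move=> M0 e0 Ml; rewrite mulr_sumr /expected_partition; apply: ler_sum => sigma _.
rewrite expRD mulrA mulrC ler_wpM2l ?expR_ge0//.
pose E := [set p : 'I_n * 'I_n | (p.1 < p.2)%N]%SET.
pose err i j := b * (1 + b) * eps * x i j + b * (x i j * (eps < x i j)%R%:R).
have err_ge0 i j : 0 <= err i j.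
  rewrite /err; move: (x i j) (x_ge0 i j) => z z0.
  by rewrite addr_ge0// !mulr_ge0// ?addr_ge0// ltW.
apply: (@le_trans _ _ (expR (\sum_(p in E)
     (b * (sigma p.1 == sigma p.2)%:R * x p.1 p.2 - err p.1 p.2)))); last first.
  rewrite expR_sum; apply: ler_prod => p _; rewrite edge_probE expR_ge0/=.
  apply: edge_factor_ge => //; first by rewrite mulr_ge0.
  by rewrite ler_piMr// lern1 leq_b1.
rewrite -expRD ler_expR sumrB sum_edges.
have : \sum_(p in E) err p.1 p.2 <= b * (1 + b) * eps * l + b * (2 * tail_weight w M).
  (* Extending the sum from edges to all ordered pairs only increases it, and makes [sum_x] and
     [sum_large_x] applicable. *)
  apply: (@le_trans _ _ (\sum_p err p.1 p.2)).
    by rewrite [leRHS](bigID (mem E))/= lerDl sumr_ge0.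
  rewrite -(pair_bigA _ err)/=.
  under eq_bigr do rewrite big_split/= -!mulr_sumr.
  by rewrite big_split/= -!mulr_sumr sum_x lerD2l ler_wpM2l// sum_large_x.
have h : b / 2 * \sum_(i < n) x i i <= b / 2 * (M + tail_weight w M).
  by rewrite ler_wpM2l ?divr_ge0// sum_diag_x.
have bM : 0 <= b * M by rewrite mulr_ge0.
have bt : 0 <= b * tail_weight w M.
  by rewrite mulr_ge0// sumr_ge0// => i _; rewrite mulr_ge0// ltW.
move: h bM bt; rewrite mulrDr; lra.
Qed.



(** * Linearization of the squares and the resulting two-sided bound *)

Let Z := mean_field_partition_function b B w.

Variables (m : R) (m_gt0 : 0 < m) (q_gt0 : (0 < q)%N).

Let weighted_square_sum (y : 'rV[R]_q) sigma :
  \sum_(k < q) b / m * y ord0 k * spin_weight w sigma k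
  - b / (2 * m ^+ 2) * l * \sum_(k < q) y ord0 k ^+ 2
  = b / (2 * l) * \sum_(k < q) spin_weight w sigma k ^+ 2
    - b / (2 * l) *
      \sum_(k < q) (spin_weight w sigma k - l / m * y ord0 k) ^+ 2.
Proof.
move: l l_gt0 (spin_weight w sigma) => L L0 S.
rewrite !mulr_sumr -!sumrB; apply: eq_bigr => k _; field.
by rewrite !lt0r_neq0.
Qed.

(** The exponential of a sum of [log_sum_exp] is a product over vertices of sums over spins;
    distributing it gives a sum over configurations. Completing the square then isolates the term
    that linearization drops. *)
Lemma linearized_partitionE (y : 'rV[R]_q) :
  expR (linearized_exponent b m B w y) =
  \sum_(sigma : {ffun 'I_n -> 'I_q})
   expR (b / (2 * l) * \sum_(k < q) spin_weight w sigma k ^+ 2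
    - b / (2 * l) *
      \sum_(k < q) (spin_weight w sigma k - l / m * y ord0 k) ^+ 2
    + \sum_(i < n) B ord0 (sigma i)).
Proof.
rewrite expRD expR_sum.
under eq_bigr do rewrite /log_sum_exp lnK ?posrE ?sum_expR_gt0//.
rewrite bigA_distr_bigA mulr_suml; apply: eq_bigr => sigma _.
rewrite -expR_sum -expRD -weighted_square_sum big_split/=; congr expR.
rewrite addrAC; congr (_ + _ + _).
by rewrite (sum_spin_weightM w sigma (fun k => b / m * y ord0 k)).
Qed.

Lemma linearized_partition_le (y : 'rV[R]_q) :
  expR (linearized_exponent b m B w y) <= Z.
Proof.
rewrite linearized_partitionE; apply: ler_sum => sigma _.
rewrite ler_expR lerD2r gerBl mulr_ge0//.
  by rewrite divr_ge0// mulr_ge0// ltW.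
by rewrite sumr_ge0// => k _; exact: sqr_ge0.
Qed.

(* Rounding [spin_weight w sigma] to the grid of mesh [l / N] loses at most
   [q (l / N)^2] in the square that linearization drops. *)
Lemma mean_field_partition_le (N : nat) : (0 < N)%N ->
  Z <= expR (b * q%:R * l / (2 * N%:R ^+ 2)) *
    \sum_(tau : {ffun 'I_q -> 'I_N.+1})
      expR (linearized_exponent b m B w (\row_k (m * (tau k)%:R / N%:R))).
Proof.
move=> N0; under eq_bigr do rewrite linearized_partitionE.
rewrite exchange_big/= mulr_sumr; apply: ler_sum => sigma _.
have NR : 0 < N%:R :> R by rewrite ltr0n.
pose s k := spin_weight w sigma k.
(* N S_k / l is rounded down; it lies in [0, N] because 0 <= S_k <= l. The corresponding y_k = m
   tau_k / N satisfies l y_k / m = l tau_k / N, so the grid in [y] is the same for all [n]. *)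
pose tau := [ffun k => inord (Num.truncn (N%:R * s k / l))] : {ffun 'I_q -> 'I_N.+1}.
have tauE k : `|s k - l / m * (m * (tau k)%:R / N%:R)| <= l / N%:R.
  have /andP[s0 sl] : 0 <= s k <= l.
    by apply: spin_weight_itv => i; exact: ltW.
  have s'0 : 0 <= N%:R * s k / l by rewrite divr_ge0 ?mulr_ge0// ltW.
  have /andP[t1 t2] := truncn_itv s'0.
  have tN : (Num.truncn (N%:R * s k / l) < N.+1)%N.
    rewrite ltnS -(ler_nat R); apply: le_trans t1 _.
    by rewrite ler_pdivrMr// ler_pM2l.
  rewrite ffunE inordK//.
  set t := Num.truncn _ in t1 t2 *.
  have -> : s k - l / m * (m * t%:R / N%:R) = l / N%:R * (N%:R * s k / l - t%:R).
    by field; rewrite !lt0r_neq0.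
  rewrite normrM ger0_norm; last by rewrite divr_ge0// ltW.
  rewrite ler_piMr//; first by rewrite divr_ge0// ltW.
  by rewrite ger0_norm ?subr_ge0// lerBlDl -natr1 in t2 *; exact: ltW.
(* For each sigma its own [tau] suffices; the other terms are positive and discarded. *)
rewrite (bigD1 tau)//= mulrDr ler_wpDr//.
  by rewrite mulr_ge0 ?expR_ge0// sumr_ge0// => ? _; exact: expR_ge0.
rewrite -expRD ler_expR addrA lerD2r addrCA lerDl subr_ge0.
apply: (@le_trans _ _ (b / (2 * l) * \sum_(k < q) (l / N%:R) ^+ 2)).
  rewrite ler_wpM2l//; first by rewrite divr_ge0// mulr_ge0// ltW.
  apply: ler_sum => k _; rewrite mxE -ler_sqrt ?sqr_ge0// !sqrtr_sqr.
  by rewrite (le_trans (tauE k))// ler_norm.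
rewrite sumr_const card_ord le_eqVlt; apply/orP; left; apply/eqP.
by rewrite -mulr_natr; field; rewrite !lt0r_neq0.
Qed.


End mean_field_bounds.

(** * Convergence of averages of Lipschitz functions of the weights *)

(** Only left continuity is at stake. The events X <= x - 1/(n+1) increase to X < x, which has the
    probability of X <= x when [x] is not an atom; monotonicity of the distribution function passes
    from this sequence to all y <= x near [x]. *)
Lemma cdf_continuous_pmf0 (R : realType) (d : measure_display)
    (T : measurableType d) (P : probability T R) (X : {RV P >-> R}) (x : R) :
  pmf X x = 0 -> {for x, continuous (cdf X)}.
Proof.
move=> X0; apply/left_right_continuousP; split; last exact: cdf_right_continuous.
pose F y := fine (cdf X y).
have FE y : cdf X y = (F y)%:E by rewrite fineK// fin_num_measure.
have F_nd : {homo F : y z / y <= z}.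
  by move=> y z yz; rewrite -lee_fin -!FE; exact: cdf_nondecreasing.
rewrite (_ : cdf X = EFin \o F); last by apply/funext.
apply: cvg_EFin; first by near=> y.
rewrite -/F /=.
pose A n := X @^-1` `]-oo, x - n.+1%:R^-1].
have mX (B : set R) : measurable B -> measurable (X @^-1` B).
  by move=> mB; rewrite -[X in measurable X]setTI; exact: measurable_funP.
have UA : \bigcup_n A n = X @^-1` `]-oo, x[.
  apply/seteqP; split=> t /=.
    move=> [n _] /=; rewrite /A/= !in_itv/= => /le_lt_trans; apply.
    by rewrite ltrBlDr ltrDl.
  rewrite in_itv/= => Xx; have := Xx; rewrite -subr_gt0 => /ltr_add_invr[n].
  rewrite add0r => hn; exists n => //; rewrite /A/= in_itv/=.
  by rewrite lerBrDr addrC -lerBrDr ltW.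
have PU : P (\bigcup_n A n) = (F x)%:E.
  rewrite UA -FE /cdf /distribution/= /pushforward.
  have -> : X @^-1` `]-oo, x] = X @^-1` `]-oo, x[ `|` X @^-1` [set x].
    apply/seteqP; split=> t /=; rewrite !in_itv/=.
      by rewrite le_eqVlt => /orP[/eqP|]; [right|left].
    by move=> [/ltW//|->].
  rewrite measureU; [|exact: mX|exact: mX|].
    rewrite [X in (_ + X)%E](_ : _ = (pmf X x)%:E).
      by rewrite X0 adde0.
    by rewrite /pmf fineK// fin_num_measure//; exact: mX.
  by rewrite -subset0 => t /=; rewrite in_itv/= => -[] /[swap] ->; rewrite ltxx.
have : P (A n) @[n --> \oo] --> (F x)%:E.
  rewrite -PU; apply: nondecreasing_cvg_mu => //.
  - by move=> n; exact: mX.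
  - by rewrite UA; exact: mX.
  - move=> n m nm; apply/subsetPset => t; rewrite /A/= !in_itv/= => /le_trans; apply.
    by rewrite lerD2l lerN2 lef_pV2 ?posrE// ler_nat.
move/fine_cvg/cvgrPdist_lt => h; apply/cvgrPdist_le => e e0.
have /(_ _ e0)[n _ /(_ n (leqnn _)) /= hn] := h.
near=> y.
have yx : y <= x by near: y; exact: nbhs_left_le.
have yn : x - n.+1%:R^-1 <= y by near: y; apply: nbhs_left_ge; rewrite ltrBlDr ltrDl.
rewrite ger0_norm ?subr_ge0 ?F_nd//.
have := F_nd _ _ yn; move: hn; rewrite -[fine _]/(F _).
by move=> /(le_lt_trans (ler_norm _)); lra.
Unshelve. all: by end_near. Qed.

(** Every discontinuity is an atom, and the countable set of atoms is Lebesgue-null, so it cannot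
    contain an interval. *)
Lemma cdf_continuity_point (R : realType) (d : measure_display)
    (T : measurableType d) (P : probability T R) (X : {RV P >-> R}) (a b : R) :
  a < b -> exists x, [/\ a < x, x < b & {for x, continuous (cdf X)}].
Proof.
move=> ab; apply: contrapT => no.
have sub : `]a, b[ `<=` [set r | 0 < pmf X r].
  move=> x /=; rewrite in_itv/= => /andP[ax xb].
  rewrite lt_neqAle pmf_ge0 andbT eq_sym; apply/negP => /eqP/cdf_continuous_pmf0 h.
  by apply: no; exists x.
have : (lebesgue_measure `]a, b[%classic <= (0 : \bar R))%E.
  rewrite -(countable_lebesgue_measure0 (pmf_gt0_countable X)).
  apply: le_measure => //; rewrite inE//.
  exact/countable_measurable/pmf_gt0_countable.
by rewrite lebesgue_measure_itv/= lte_fin ab -EFinB lee_fin leNgt subr_gt0 ab.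
Qed.

(** * Clamped functions and their interpolation by step functions *)

Definition average {R : realType} {n : nat} (w : 'I_n -> R) (f : R -> R) : R :=
  (\sum_(i < n) f (w i)) / n%:R.

Definition clamp {R : realType} (M t : R) : R := Num.max 0 (Num.min t M).

Definition lipschitz {R : realType} (L : R) (f : R -> R) : Prop :=
  forall s t, `|f s - f t| <= L * `|s - t|.

Section clamp.
Context {R : realType}.
Implicit Types L M s t : R.

Lemma clampP M t : 0 <= M ->
  [\/ t <= 0 /\ clamp M t = 0, [/\ 0 <= t, t <= M & clamp M t = t]
    | M <= t /\ clamp M t = M].
Proof.
move=> M0; rewrite /clamp; have [tM|Mt] := leP t M.
  have [t0|t0] := leP 0 t; first by constructor 2; split.
  by constructor 1; split; [exact: ltW|].
by constructor 3; rewrite max_r//; split => //; exact: ltW.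
Qed.

Lemma clamp_itv M t : 0 <= M -> 0 <= clamp M t <= M.
Proof. by move=> M0; case: (clampP t M0) => [[? ->]|[? ? ->]|[? ->]]; lra. Qed.

Lemma lipschitz_clamp M : 0 <= M -> lipschitz 1 (clamp M).
Proof.
move=> M0 s t; rewrite mul1r.
by case: (clampP t M0) => [[? ->]|[? ? ->]|[? ->]];
  case: (clampP s M0) => [[? ->]|[? ? ->]|[? ->]];
  rewrite ler_norml; apply/andP; have := ler_norm (s - t);
  have := ler_norm (t - s); rewrite [`|t - s|]distrC; split; lra.
Qed.

Lemma lipschitz_comp L f M : 0 <= L -> 0 <= M -> lipschitz L f ->
  lipschitz L (f \o clamp M).
Proof.
move=> L0 M0 fL s t /=; apply: le_trans (fL _ _) _.
by rewrite ler_wpM2l//; have := lipschitz_clamp M0 s t; rewrite mul1r.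
Qed.

Lemma lipschitz_continuous L f : lipschitz L f -> continuous f.
Proof.
move=> fL x; apply/cvgrPdist_le => e e0; near=> y.
apply: le_trans (fL _ _) _.
apply: (@le_trans _ _ ((`|L| + 1) * `|x - y|)).
  by rewrite ler_wpM2r// (le_trans (ler_norm _))// lerDl.
rewrite mulrC -ler_pdivlMr; last by rewrite ltr_wpDl.
near: y; apply: cvgr_dist_le; first exact: cvg_id.
by rewrite divr_gt0// ltr_wpDl.
Unshelve. all: by end_near. Qed.

Lemma lipschitz_measurable L f : lipschitz L f -> measurable_fun setT f.
Proof. by move/lipschitz_continuous; exact: continuous_measurable_fun. Qed.

(** For nondecreasing [x], the value of [f] at the first of x_0, ..., x_N not below [t], and f(x_N)
    if there is none. Summation by parts puts it in terms of the indicators of t <= x_j, whose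
    averages are values of a distribution function. *)
Definition step_interp (f : R -> R) (x : nat -> R) (N : nat) (t : R) : R :=
  f (x N) - \sum_(j < N) (f (x j.+1) - f (x j)) * (t <= x j)%R%:R.

(** Induction on [N]. For t <= x_N the new summand cancels the change from f(x_N) to f(x_{N+1}), and
    the clamp is unchanged. For t > x_N all indicators vanish, and the clamped [t] lies between x_N
    and x_{N+1}. *)
Lemma step_interp_approx L f (x : nat -> R) (mesh : R) : 0 <= L -> lipschitz L f ->
    0 <= x 0 <= mesh -> (forall j, x j <= x j.+1 <= x j + mesh) ->
  forall N t, `|step_interp f x N t - f (clamp (x N) t)| <= L * mesh.
Proof.
move=> L0 fL /andP[x0 x0m] xS.
have xpos j : 0 <= x j.
  by elim: j => // j IH; have /andP[] := xS j; lra.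
have x_nd : {homo x : i j / (i <= j)%N >-> i <= j}.
  by apply: homo_leq => // [? ? ?|j]; [exact: le_trans|have /andP[] := xS j].
have close a b : `|a - b| <= mesh -> `|f a - f b| <= L * mesh.
  by move=> ab; apply: le_trans (fL _ _) _; rewrite ler_wpM2l.
elim=> [|N IH] t; rewrite /step_interp.
  rewrite big_ord0 subr0; apply: close.
  by have /andP[] := clamp_itv t (xpos 0) => ? ?; rewrite ger0_norm; lra.
have /andP[xN xNm] := xS N.
have [tx|xt] := leP t (x N).
  rewrite big_ord_recr/= tx mulr1.
  have -> : clamp (x N.+1) t = clamp (x N) t.
    by rewrite /clamp !min_l//; exact: le_trans xN.
  apply: le_trans (IH t); rewrite /step_interp le_eqVlt.
  by apply/orP; left; apply/eqP; congr `|_|; lra.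
rewrite big1 ?subr0 => [|j _].
  apply: close.
  by case: (clampP t (xpos N.+1)) => [[? ->]|[? ? ->]|[? ->]];
    rewrite ger0_norm; have := xpos N; lra.
by rewrite leNgt (le_lt_trans (x_nd _ N (ltn_ord j)) xt) mulr0.
Qed.

End clamp.

Section average.
Context {R : realType} {n : nat} (w : 'I_n -> R) (n_gt0 : (0 < n)%N).

Lemma average_cst (c : R) : average w (fun=> c) = c.
Proof.
rewrite /average sumr_const card_ord -[X in X / _]mulr_natr mulfK//.
by rewrite pnatr_eq0 -lt0n.
Qed.

Lemma average_le (f g : R -> R) : (forall i, f (w i) <= g (w i)) ->
  average w f <= average w g.
Proof. by move=> fg; rewrite ler_wpM2r ?invr_ge0//; exact: ler_sum. Qed.

Lemma average_dist (f g h : R -> R) :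
    (forall i, `|f (w i) - g (w i)| <= h (w i)) ->
  `|average w f - average w g| <= average w h.
Proof.
move=> fgh; rewrite /average -mulrBl -sumrB normrM [X in _ * X]ger0_norm//.
rewrite ler_wpM2r//; apply: le_trans (ler_norm_sum _ _ _) _.
exact: ler_sum.
Qed.

Lemma average_step_interp (f : R -> R) (x : nat -> R) (N : nat) :
  average w (step_interp f x N)
  = f (x N) - \sum_(j < N) (f (x j.+1) - f (x j)) * empirical_cdf w (x j).
Proof.
rewrite /average /step_interp sumrB mulrBl; congr (_ - _).
  exact: (average_cst (f (x N))).
rewrite exchange_big/= mulr_suml; apply: eq_bigr => j _.
by rewrite -mulr_sumr mulrA.
Qed.

End average.

(** * Expectations of bounded functions and of step functions *)

Section expectation_bounds.
Context {R : realType} {d : measure_display} {T : measurableType d}.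
Variable Q : probability T R.

Lemma bounded_integrable (f : T -> R) (C : R) : measurable_fun setT f ->
  (forall t, `|f t| <= C) -> Q.-integrable setT (EFin \o f).
Proof.
move=> mf fC; apply: (@le_integrable _ _ _ _ _ _ _ (EFin \o cst C)) => //.
- exact/measurable_EFinP.
- by move=> t _ /=; rewrite lee_fin (le_trans (fC t))// ler_norm.
- exact: finite_measure_integrable_cst.
Qed.

Lemma Rintegral_dist (f g h : T -> R) :
    Q.-integrable setT (EFin \o f) -> Q.-integrable setT (EFin \o g) ->
    Q.-integrable setT (EFin \o h) -> (forall t, `|f t - g t| <= h t) ->
  `|\int[Q]_t f t - \int[Q]_t g t| <= \int[Q]_t h t.
Proof.
move=> fi gi hi fgh; rewrite -RintegralB//.
have fgi : Q.-integrable setT (EFin \o (fun t => f t - g t)).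
  rewrite (_ : _ \o _ = ((EFin \o f) \- (EFin \o g))%E); first exact: integrableB.
  by apply/funext => t /=; rewrite EFinB.
apply: le_trans (le_normr_Rintegral _ fgi) _ => //.
by apply: le_Rintegral => //; exact: integrable_norm.
Qed.

Lemma Rintegral_cst1 (c : R) : \int[Q]_t (fun=> c) t = c.
Proof. by rewrite Rintegral_cst//= probability_setT mulr1. Qed.

Context (W : {RV Q >-> R}).

(** Counterpart of [average_step_interp] with [cdf W] in place of the empirical distribution
    function, so that comparing the two only involves the points [x j]. *)
Lemma Rintegral_step_interp (f : R -> R) (x : nat -> R) (N : nat) :
  Q.-integrable setT (EFin \o (fun t => step_interp f x N (W t))) /\
  \int[Q]_t step_interp f x N (W t)
  = f (x N) - \sum_(j < N) (f (x j.+1) - f (x j)) * fine (cdf W (x j)).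
Proof.
pose A (j : 'I_N) := W @^-1` `]-oo, x j].
have mA j : measurable (A j).
  by rewrite -[X in measurable X]setTI; exact: measurable_funP.
pose g (j : 'I_N) t := (f (x j.+1) - f (x j)) * \1_(A j) t : R.
have gi j : Q.-integrable setT (EFin \o g j).
  rewrite (_ : _ \o _ = fun t => ((f (x j.+1) - f (x j))%:E * (\1_(A j) t)%:E)%E).
    by apply: integrableZl => //; exact: integrable_indic.
  by apply/funext => t /=; rewrite EFinM.
have sgi : Q.-integrable setT (EFin \o (fun t => \sum_j g j t)).
  rewrite (_ : _ \o _ = fun t => (\sum_j (g j t)%:E)%E).
    by apply: integrable_sum => // j _; exact: gi.
  by apply/funext => t /=; rewrite sumEFin.
have ci : Q.-integrable setT (EFin \o cst (f (x N))).
  exact: finite_measure_integrable_cst.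
have sE : (fun t => step_interp f x N (W t))
    = (fun t => cst (f (x N)) t - \sum_j g j t).
  apply/funext => t; rewrite /step_interp /g; congr (_ - _).
  apply: eq_bigr => j _; rewrite indicE /A; congr (_ * (nat_of_bool _)%:R).
  by apply/idP/idP; rewrite inE /= in_itv /=.
split.
  rewrite sE (_ : _ \o _ =
    ((EFin \o cst (f (x N))) \- (EFin \o (fun t => (\sum_j g j t)%R)))%E).
    exact: integrableB.
  by apply/funext => t /=; rewrite EFinB.
rewrite sE RintegralB// Rintegral_cst1; congr (_ - _).
rewrite /Rintegral.
under eq_integral do rewrite -sumEFin.
rewrite integral_sum// -sum_fine//; last first.
  by move=> j _; apply: integrable_fin_num; [exact: measurableT|exact: gi].
apply: eq_bigr => j _; rewrite -[LHS]/(Rintegral Q setT (g j)).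
rewrite RintegralZl//; last exact: integrable_indic.
by congr (_ * _); rewrite /Rintegral integral_indic// setIT.
Qed.

End expectation_bounds.

(** * Uniform integrability of the weights from the tail bound *)

Section uniform_integrability.
Context {R : realType}.

(** If v > M, the largest [j] with 2^j M < v alone contributes 2^{j+1} M >= v. *)
Lemma dyadic_tail (v M : R) (J : nat) : 0 < M -> 0 <= v -> v <= 2 ^+ J * M ->
  v * (M < v)%R%:R <= \sum_(j < J) 2 * (2 ^+ j * M) * (2 ^+ j * M < v)%R%:R.
Proof.
move=> M0 v0; elim: J => [|J IH].
  by rewrite expr0 mul1r big_ord0 leNgt => /negbTE ->; rewrite mulr0.
have t0 j : 0 <= 2 ^+ j * M by rewrite mulr_ge0// ltW.
move=> vJ; rewrite big_ord_recr/=; have [vle|vgt] := leP v (2 ^+ J * M).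
  by rewrite mulr0 addr0 IH.
apply: ler_wpDl; first by rewrite sumr_ge0// => j _; rewrite mulr_ge0// mulr_ge0.
rewrite mulr1; apply: (@le_trans _ _ v).
  by rewrite ler_piMr// lern1 leq_b1.
by rewrite mulrA -exprS.
Qed.

Lemma sum_geometric_le (r : R) (J : nat) : 0 <= r < 1 ->
  \sum_(j < J) r ^+ j <= (1 - r)^-1.
Proof.
move=> /andP[r0 r1]; rewrite -[leRHS]mul1r ler_pdivlMr ?subr_gt0//.
have -> : (\sum_(j < J) r ^+ j) * (1 - r) = 1 - r ^+ J.
  elim: J => [|J IH]; first by rewrite big_ord0 mul0r expr0 subrr.
  by rewrite big_ord_recr/= mulrDl IH exprSr; ring.
by rewrite gerBl exprn_ge0.
Qed.

Lemma powR2N_lt1 (s : R) : 0 < s -> 2 `^ (- s) < 1 :> R.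
Proof.
move=> s0; rewrite powRN invf_lt1 ?powR_gt0//.
have : (1 : R) `^ s < 2 `^ s by rewrite gt0_ltr_powR ?nnegrE// ltr1n.
by rewrite powR1.
Qed.

(** Dyadic decomposition at the levels X_j = 2^j M: the tail is at most the sum of 2 X_j (1 -
    F(X_j)), and the tail bound makes each term at most 2 c X_j^{-(tau - 2)}. This is a geometric
    series because tau > 2. *)
Lemma tail_weight_le (n : nat) (w : 'I_n -> R) (c tau M : R) :
    (0 < n)%N -> (forall i, 0 < w i) -> 0 < c -> 2 < tau -> 1 <= M ->
    (forall x, 1 <= x -> 1 - empirical_cdf w x <= c * x `^ (- (tau - 1))) ->
  tail_weight w M / n%:R <= 2 * c / (1 - 2 `^ (- (tau - 2))) * M `^ (- (tau - 2)).
Proof.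
move=> n0 w0 c0 tau2 M1 hF; set s := tau - 2.
have M0 : 0 < M by lra.
have s0 : 0 < s by rewrite /s; lra.
(* Enough levels to exceed every weight: 2^J > J > l >= w_i. The final bound does not depend on
   [J]. *)
pose J := (Num.truncn (total_weight w)).+1.
have wJ i : w i <= 2 ^+ J * M.
  apply: (@le_trans _ _ (total_weight w)).
    rewrite /total_weight (bigD1 i)//= lerDl sumr_ge0// => j _; exact: ltW.
  apply: (@le_trans _ _ (2 ^+ J)); last by rewrite ler_peMr.
  apply: (@le_trans _ _ J%:R); first by rewrite ltW// truncnS_gt.
  by rewrite -natrX ler_nat ltnW// ltn_expl.
have [X XE] : exists X : nat -> R, forall j, X j = 2 ^+ j * M by eexists.
have X1 j : 1 <= X j by rewrite XE mulr_ege1// exprn_ege1// ler1n.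
have nR : n%:R != 0 :> R by rewrite pnatr_eq0 -lt0n.
have h1 : tail_weight w M / n%:R <=
    \sum_(j < J) 2 * (X j * (1 - empirical_cdf w (X j))).
  rewrite ler_pdivrMr ?ltr0n// mulr_suml.
  apply: (@le_trans _ _ (\sum_(i < n) \sum_(j < J) 2 * X j * (X j < w i)%R%:R)).
    apply: ler_sum => i _; under eq_bigr do rewrite XE.
    by apply: dyadic_tail => //; exact: ltW.
  rewrite exchange_big/=; apply: ler_sum => j _.
  rewrite le_eqVlt; apply/orP; left; apply/eqP.
  rewrite -mulr_sumr -!mulrA; congr (_ * (_ * _)).
  rewrite mulrBl mul1r /empirical_cdf divfK//.
  rewrite (_ : n%:R = \sum_(i < n) (1 : R)); last by rewrite sumr_const card_ord.
  rewrite -sumrB; apply: eq_bigr => i _.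
  by have [?|?] := leP (w i) (X j); rewrite ?subrr ?subr0.
apply: le_trans h1 _.
have r0 : 0 <= (2 : R) `^ (- s) by exact: powR_ge0.
have r1 : (2 : R) `^ (- s) < 1.
  exact: powR2N_lt1.
apply: (@le_trans _ _ (\sum_(j < J) 2 * c * M `^ (- s) * (2 `^ (- s)) ^+ j)).
  apply: ler_sum => j _; rewrite -!mulrA ler_pM2l//.
  have X0 : 0 < X j by exact: lt_le_trans (X1 j).
  apply: (@le_trans _ _ (X j * (c * X j `^ (- (tau - 1))))).
    by rewrite ler_pM2l// hF.
  rewrite mulrCA ler_pM2l// -{1}(powRr1 (ltW X0)) -powRD; last first.
    by rewrite (gt_eqF X0) implybT.
  have -> : 1 - (tau - 1) = - s by rewrite /s; ring.
  rewrite XE powRM ?exprn_ge0 ?(ltW M0)// mulrC.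
  by rewrite -!powR_mulrn ?powR_ge0// -!powRrM [_ * - s]mulrC.
rewrite -mulr_sumr mulrAC ler_wpM2r ?powR_ge0//.
rewrite ler_wpM2l ?mulr_ge0// ?(ltW c0)//.
by rewrite sum_geometric_le// r0.
Qed.

Lemma powRN_small (C s e : R) : 0 < C -> 0 < s -> 0 < e ->
  exists2 M, 1 <= M & C * M `^ (- s) <= e.
Proof.
move=> C0 s0 e0; exists (Num.max 1 ((C / e) `^ s^-1)); first by rewrite le_max lexx.
set M := Num.max _ _.
have M0 : 0 < M by rewrite lt_max ltr01.
rewrite powRN ler_pdivrMr ?powR_gt0// mulrC -ler_pdivrMr//.
apply: (@le_trans _ _ (((C / e) `^ s^-1) `^ s)).
  have Ce : 0 <= C / e by rewrite divr_ge0// ltW.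
  by rewrite -powRrM mulVf ?lt0r_neq0// powRr1.
by rewrite ge0_ler_powR ?nnegrE ?powR_ge0 ?(ltW s0) ?(ltW M0)// le_max lexx orbT.
Qed.

Lemma tail_weight_small (w : forall n, 'I_n -> R) (c tau : R) :
    (forall n (i : 'I_n), 0 < w n i) -> 0 < c -> 2 < tau ->
    (forall (n : nat) (x : R), (0 < n)%N -> 1 <= x ->
      1 - empirical_cdf (w n) x <= c * x `^ (- (tau - 1))) ->
  forall e : R, 0 < e -> exists2 M : R, 1 <= M &
    forall n, (0 < n)%N -> tail_weight (w n) M / n%:R <= e.
Proof.
move=> w0 c0 tau2 hF e e0.
have s0 : 0 < tau - 2 by lra.
have C0 : 0 < 2 * c / (1 - 2 `^ (- (tau - 2))).
  by rewrite divr_gt0 ?mulr_gt0// subr_gt0 powR2N_lt1.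
have [M M1 hM] := powRN_small C0 s0 e0; exists M => // n n0.
apply: le_trans hM; apply: tail_weight_le => // x x1; exact: hF.
Qed.

End uniform_integrability.

(** * Convergence for clamped Lipschitz functions *)

Section bounded_lipschitz.
Context {R : realType} (w : forall n, 'I_n -> R).
Arguments w : clear implicits.
Context {d : measure_display} {T : measurableType d} (Q : probability T R).
Context (W : {RV Q >-> R}).
Hypothesis cvgW : cvg_in_distribution (fun n => empirical_cdf (w n)) W.

(** Convergence in distribution is usable only at continuity points of [cdf W]. The clamped function
    is therefore uniformly approximated by a step function whose jumps sit at such points. *)
Lemma cvg_average_clamp (L M : R) (f : R -> R) : 0 <= L -> 0 <= M ->
    lipschitz L f ->
  average (w n) (f \o clamp M) @[n --> \oo]
    --> \int[Q]_t f (clamp M (W t)).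
Proof.
move=> L0 M0 fL; apply/cvgrPdist_le => e e0.
(* The grid will have mesh at most 2 delta, hence interpolation error 2 L delta <= e / 4. Using L +
   1 covers the case L = 0. *)
pose delta := e / (8 * (L + 1)).
have L1 : 0 < L + 1 by lra.
have d0 : 0 < delta by rewrite divr_gt0// mulr_gt0.
pose g := f \o clamp M.
have gL : lipschitz L g by exact: lipschitz_comp.
have /choice[x xP] : forall j : nat, exists x, [/\ delta * j%:R < x,
    x < delta * j.+1%:R & {for x, continuous (cdf W)}].
  by move=> j; apply: cdf_continuity_point; rewrite ltr_pM2l// ltr_nat.
pose N := (Num.truncn (M / delta)).+1.
have xN : M <= x N.
  have [/ltW + _ _] := xP N; apply: le_trans; rewrite -ler_pdivrMl// mulrC.
  by rewrite ltW// truncnS_gt.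
have x0 : 0 <= x 0 <= delta * 2.
  by have [+ + _] := xP 0%N; rewrite mulr0 mulr1; lra.
have xS j : x j <= x j.+1 <= x j + delta * 2.
  have [+ + _] := xP j; have [+ + _] := xP j.+1.
  by rewrite -!natr1 !mulrDr; lra.
(* Since x_N >= M, a first clamp at x_N is absorbed by the clamp at [M]. *)
have gE t : g (clamp (x N) t) = g t.
  have xN0 : 0 <= x N by exact: le_trans xN.
  rewrite /g /=; congr f.
  case: (clampP t xN0) => [[h ->]|[? ? ->]|[h ->]] //.
    by case: (clampP 0 M0) => [[? ->]|[? ? ->]|[? ->]];
      case: (clampP t M0) => [[? ->]|[? ? ->]|[? ->]]; lra.
  by case: (clampP (x N) M0) => [[? ->]|[? ? ->]|[? ->]];
    case: (clampP t M0) => [[? ->]|[? ? ->]|[? ->]]; lra.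
pose h := step_interp g x N.
have Lmesh : L * (delta * 2) <= e / 4.
  have : delta * (8 * (L + 1)) = e by rewrite divfK// mulf_neq0// gt_eqF.
  rewrite !mulrDr mulr1 => <-.
  have : 0 <= delta * L by rewrite mulr_ge0// ltW.
  by rewrite mulrCA; lra.
have gh t : `|h t - g t| <= e / 4.
  apply: le_trans Lmesh; rewrite -gE.
  exact: step_interp_approx.
have [hi hE] := Rintegral_step_interp W g x N.
have avgh : average (w n) h @[n --> \oo] --> \int[Q]_t h (W t).
  rewrite hE.
  have : g (x N) - \sum_(j < N) (g (x j.+1) - g (x j)) * empirical_cdf (w n) (x j)
      @[n --> \oo] -->
    g (x N) - \sum_(j < N) (g (x j.+1) - g (x j)) * fine (cdf W (x j)).
    apply: cvgB; first exact: cvg_cst.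
    apply: cvg_big => [|j _]; [exact: add_continuous|apply: cvgMl_tmp].
    have [_ _ /cvgW] := xP j.
    by rewrite -[cdf W (x j)]fineK ?fin_num_measure// => /fine_cvg.
  apply: cvg_trans; apply: near_eq_cvg; near=> n.
  rewrite average_step_interp//; near: n; exact: nbhs_infty_gt.
have mW : measurable_fun setT W by [].
have gi : Q.-integrable setT (EFin \o (g \o W)).
  apply: (@bounded_integrable _ _ _ _ _ (`|f 0| + L * M)).
    exact: measurableT_comp (lipschitz_measurable gL) mW.
  move=> t; have := fL (clamp M (W t)) 0; have /andP[c0 cM] := clamp_itv (W t) M0.
  rewrite subr0 [`|clamp _ _|]ger0_norm// => fc.
  have := ler_normD (f (clamp M (W t)) - f 0) (f 0); rewrite subrK /=.
  have := ler_wpM2l L0 cM; lra.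
have Egh : `|\int[Q]_t h (W t) - \int[Q]_t g (W t)| <= e / 4.
  rewrite -[leRHS](Rintegral_cst1 Q); apply: Rintegral_dist => //.
  exact: finite_measure_integrable_cst.
have avg_e : \forall n \near \oo,
    `|\int[Q]_t h (W t) - average (w n) h| <= e / 4.
  by move/cvgrPdist_le : avgh; apply; lra.
near=> n.
have n0 : (0 < n)%N by near: n; exact: nbhs_infty_gt.
have a1 : `|average (w n) h - average (w n) g| <= e / 4.
  by rewrite -[leRHS](average_cst (w n) n0); exact: average_dist.
have a2 : `|\int[Q]_t h (W t) - average (w n) h| <= e / 4 by near: n.
have -> : \int[Q]_t f (clamp M (W t)) = \int[Q]_t g (W t) by [].
by move: Egh a1 a2; rewrite -/g !ler_norml; lra.
Unshelve. all: by end_near. Qed.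

End bounded_lipschitz.

(** A Lipschitz substitute for the discontinuous tail t 1{t > M}; by [dist_clamp] it is exactly the
    error of truncating a nonnegative [t] at [M]. *)
Definition excess {R : realType} (M t : R) : R := Num.max 0 (t - M).

Section excess.
Context {R : realType}.
Implicit Types L M t v : R.

Lemma excess_ge0 M t : 0 <= excess M t.
Proof. by rewrite /excess le_max lexx. Qed.

Lemma excessP M t : [\/ t <= M /\ excess M t = 0 | M <= t /\ excess M t = t - M].
Proof.
by rewrite /excess; have [h|h] := leP 0 (t - M); [right|left]; split => //; lra.
Qed.

Lemma lipschitz_excess M : lipschitz 1 (excess M).
Proof.
move=> s t; rewrite mul1r.
by case: (excessP M s) => [[? ->]|[? ->]]; case: (excessP M t) => [[? ->]|[? ->]];
  rewrite ler_norml; apply/andP; have := ler_norm (s - t);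
  have := ler_norm (t - s); rewrite [`|t - s|]distrC; split; lra.
Qed.

Lemma excess_clamp_nd M t :
  {homo (fun k => excess M (clamp k t)) : k k' / 0 <= k /\ k <= k' >-> k <= k'}.
Proof.
move=> k k' [k0 kk']; have k'0 : 0 <= k' by exact: le_trans kk'.
by case: (clampP t k0) => [[? ->]|[? ? ->]|[? ->]];
  case: (clampP t k'0) => [[? ->]|[? ? ->]|[? ->]];
  rewrite /excess ge_max !le_max lexx/=; apply/orP; right; lra.
Qed.

Lemma excess_clamp_id M k t : 0 <= M -> `|t| <= k ->
  excess M (clamp k t) = excess M t.
Proof.
move=> M0 tk; have k0 : 0 <= k by exact: le_trans tk.
move: tk; rewrite ler_norml => /andP[? ?].
case: (clampP t k0) => [[? ->]|[? ? ->]|[? ->]] //.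
  by case: (excessP M 0) => [[? ->]|[? ->]];
    case: (excessP M t) => [[? ->]|[? ->]]; lra.
by congr excess; lra.
Qed.

Lemma excess_clamp_le M k t : 0 <= k -> 0 <= t ->
  excess M (clamp k t) <= excess M t.
Proof.
move=> k0 t0; case: (clampP t k0) => [[? ->]|[? ? ->]|[? ->]] //;
  rewrite /excess ge_max !le_max lexx/=; apply/orP; right; lra.
Qed.

Lemma dist_clamp M t : 0 <= M -> `|Num.max 0 t - clamp M t| = excess M t.
Proof.
move=> M0; case: (clampP t M0) => [[? ->]|[? ? ->]|[? ->]].
- by rewrite max_l// subrr normr0; case: (excessP M t) => [[? ->]|[? ->]]; lra.
- by rewrite max_r// subrr normr0; case: (excessP M t) => [[? ->]|[? ->]]; lra.
- rewrite max_r; last by lra.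
  by rewrite ger0_norm ?subr_ge0//; case: (excessP M t) => [[? ->]|[? ->]]; lra.
Qed.

Lemma average_excess_le (n : nat) (w : 'I_n -> R) M :
  (forall i, 0 < w i) -> 0 <= M ->
  average w (excess M) <= tail_weight w M / n%:R.
Proof.
move=> w0 M0; rewrite /average ler_wpM2r// /tail_weight; apply: ler_sum => i _.
have [h|h] := ltP M (w i); case: (excessP M (w i)) => [[? ->]|[? ->]] //=;
  rewrite ?mulr1 ?mulr0//; lra.
Qed.

End excess.

(** * From clamped to arbitrary Lipschitz functions of the weights *)

Section weak_convergence.
Context {R : realType} (w : forall n, 'I_n -> R).
Arguments w : clear implicits.
Hypothesis w_gt0 : forall n (i : 'I_n), 0 < w n i.
Context {d : measure_display} {T : measurableType d} (Q : probability T R).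
Context (W : {RV Q >-> R}).
Hypothesis cvgW : cvg_in_distribution (fun n => empirical_cdf (w n)) W.

Let mW : measurable_fun setT W. Proof. by []. Qed.

(** Positive weights make the empirical distribution functions vanish at every negative continuity
    point, hence [cdf W] vanishes on the negative axis. The event W < 0 is a countable union of the
    null events W <= -1/(k+1). *)
Lemma ae_ge0_limit : {ae Q, forall t, 0 <= W t}.
Proof.
have neg x : x < 0 -> Q (W @^-1` `]-oo, x]) = 0%E.
  move=> x0; have [y [xy y0 /cvgW cy]] := cdf_continuity_point W x0.
  have cy0 : cdf W y = 0%E.
    apply/esym/(cvg_unique _ _ cy) => //.
    rewrite (_ : (fun n => _) = fun=> 0%E); first exact: cvg_cst.
    apply/funext => n; rewrite /empirical_cdf big1 ?mul0r// => i _.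
    by rewrite leNgt (lt_trans y0).
  apply/eqP; rewrite eq_le measure_ge0 andbT -cy0.
  exact: (cdf_nondecreasing W (ltW xy)).
have : Q.-negligible (\bigcup_k W @^-1` `]-oo, - k.+1%:R^-1]).
  apply: negligible_bigcup => k; exists (W @^-1` `]-oo, - k.+1%:R^-1]); split => //.
    by rewrite -[X in measurable X]setTI; exact: measurable_funP.
  by apply: neg; rewrite oppr_lt0 invr_gt0.
apply: negligibleS => t /= /negP; rewrite -ltNge => Wt.
have /ltr_add_invr[k] : 0 < - W t by rewrite oppr_gt0.
by rewrite add0r => hk; exists k => //=; rewrite in_itv/= lerNr ltW.
Qed.

(** For each level [k] the clamped excess is bounded, so its expectation is a limit of averages that
    are at most [e]. Monotone convergence in [k] removes the clamp; the integral is extended-real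
    because integrability is only deduced from this bound. *)
Lemma integral_excess_le (M e : R) : 0 <= M ->
    (forall n, (0 < n)%N -> average (w n) (excess M) <= e) ->
  (\int[Q]_t (excess M (W t))%:E <= e%:E)%E.
Proof.
move=> M0 he.
pose g (k : nat) t := (excess M (clamp k%:R (W t)))%:E.
have mclamp (k : nat) : measurable_fun setT (fun t => excess M (clamp k%:R (W t))).
  apply: (measurableT_comp (f := excess M \o clamp k%:R)) => //.
  by apply: (@lipschitz_measurable _ 1); apply: lipschitz_comp => //;
    exact: lipschitz_excess.
have mg k : measurable_fun setT (g k) by exact/measurable_EFinP.
have g0 k t : setT t -> (0 <= g k t)%E by move=> _; rewrite lee_fin excess_ge0.
have gnd t : setT t -> {homo g^~ t : k k' / (k <= k')%N >-> (k <= k')%E}.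
  by move=> _ k k' kk'; rewrite lee_fin excess_clamp_nd// ler_nat.
have lim_g t : limn (g^~ t) = (excess M (W t))%:E.
  apply/cvg_lim => //; apply: cvg_near_cst; near=> k; rewrite /g excess_clamp_id//.
  by near: k; exact: nbhs_infty_ger.
have cvg_g : (\int[Q]_t g k t)%E @[k --> \oo] --> (\int[Q]_t (excess M (W t))%:E)%E.
  under [X in _ --> X]eq_integral do rewrite -lim_g.
  exact: cvg_monotone_convergence.
apply: (cvge_to_le cvg_g).
near=> k.
have ik : Q.-integrable setT (EFin \o (fun t => excess M (clamp k%:R (W t)))).
  apply: (@bounded_integrable _ _ _ _ _ k%:R) => // t.
  have /andP[? ?] := clamp_itv (W t) (ler0n R k).
  by rewrite ger0_norm ?excess_ge0//;
    case: (excessP M (clamp k%:R (W t))) => [[? ->]|[? ->]]; lra.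
rewrite -[leLHS]fineK; last exact: integrable_fin_num.
rewrite lee_fin.
have := cvg_average_clamp cvgW ler01 (ler0n R k) (lipschitz_excess M).
move/cvgr_to_le; apply.
near=> n.
have n0 : (0 < n)%N by near: n; exact: nbhs_infty_gt.
apply: le_trans (he n n0); apply: average_le => // i /=.
by rewrite excess_clamp_le// ltW.
Unshelve. all: by end_near. Qed.

Hypothesis uniform_excess : forall e : R, 0 < e -> exists2 M : R, 0 <= M &
  forall n, (0 < n)%N -> average (w n) (excess M) <= e.

Let excess_integrable (M e : R) : 0 <= M ->
    (forall n, (0 < n)%N -> average (w n) (excess M) <= e) ->
  Q.-integrable setT (EFin \o (excess M \o W)) /\
  \int[Q]_t excess M (W t) <= e.
Proof.
move=> M0 he; have hI := integral_excess_le M0 he.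
have ei : Q.-integrable setT (EFin \o (excess M \o W)).
  apply/integrableP; split.
    apply/measurable_EFinP; apply: measurableT_comp => //.
    exact: lipschitz_measurable (lipschitz_excess M).
  rewrite (eq_integral (fun t => (excess M (W t))%:E)); last first.
    by move=> t _ /=; rewrite ger0_norm ?excess_ge0.
  by apply: le_lt_trans hI _; rewrite ltry.
split => //; rewrite -lee_fin /Rintegral fineK//.
exact: integrable_fin_num.
Qed.

(** Clamping the argument at [M] changes [f] by at most L times the excess, which is small both on
    average, uniformly in [n], and in expectation. In between, [cvg_average_clamp] applies. *)
Lemma cvg_average_lipschitz (L : R) (f : R -> R) : 0 <= L -> lipschitz L f ->
  exists2 r, 'E_Q[f \o W]%E = r%:E & average (w n) f @[n --> \oo] --> r.
Proof.
move=> L0 fL.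
(* A version of [W] that is nonnegative everywhere, so that [dist_clamp] holds pointwise. *)
pose V t := Num.max 0 (W t).
have mV : measurable_fun setT V by exact: measurable_maxr.
have mf := lipschitz_measurable fL.
have fVi : Q.-integrable setT (EFin \o (f \o V)).
  have [M M0 hM] := uniform_excess ltr01.
  have [ei _] := excess_integrable M0 hM.
  pose g t := `|f 0| + L * M + L * excess M (W t).
  apply: (@le_integrable _ _ _ _ _ _ _ (EFin \o g)) => //.
  - by apply/measurable_EFinP; exact: measurableT_comp.
  - move=> t _ /=; rewrite lee_fin [leRHS]ger0_norm; last first.
      by rewrite !addr_ge0// mulr_ge0// excess_ge0.
    have := fL (V t) 0; rewrite subr0.
    have V0 : 0 <= V t by rewrite le_max lexx.
    rewrite (ger0_norm V0) => hf.
    have := ler_normD (f (V t) - f 0) (f 0); rewrite subrK => hn.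
    have : L * V t <= L * (M + excess M (W t)).
      rewrite ler_wpM2l// -(dist_clamp (W t) M0) -/(V t).
      have /andP[_ cM] := clamp_itv (W t) M0.
      have := ler_norm (V t - clamp M (W t)); lra.
    by rewrite /g mulrDr; lra.
  - rewrite (_ : _ \o g = ((EFin \o cst (`|f 0| + L * M)%R) \+
      (fun t => L%:E * (EFin \o (excess M \o W)) t))%E).
      apply: integrableD => //; first exact: finite_measure_integrable_cst.
      exact: integrableZl.
    by apply/funext => t /=; rewrite /g EFinD EFinM.
exists (\int[Q]_t f (V t)).
  rewrite unlock /Rintegral fineK; last exact: integrable_fin_num.
  apply: ae_eq_integral => //.
  - by apply/measurable_EFinP; exact: measurableT_comp.
  - by apply/measurable_EFinP; exact: measurableT_comp.
  - apply: filterS ae_ge0_limit => t Wt _ /=.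
    by rewrite /V max_r.
apply/cvgrPdist_le => e e0.
have L1 : 0 < L + 1 by lra.
have eta0 : 0 < e / (3 * (L + 1)) by rewrite divr_gt0// mulr_gt0.
set eta := e / _ in eta0.
have Leta : L * eta <= e / 3.
  have : eta * (3 * (L + 1)) = e by rewrite divfK// mulf_neq0// gt_eqF.
  by move=> <-; lra.
have [M M0 hM] := uniform_excess eta0.
have [ei eI] := excess_integrable M0 hM.
have Lei : Q.-integrable setT (EFin \o (fun t => L * excess M (W t))).
  rewrite (_ : _ \o _ = (fun t => L%:E * (EFin \o (excess M \o W)) t)%E).
    exact: integrableZl.
  by apply/funext => t /=; rewrite EFinM.
have fci : Q.-integrable setT (EFin \o (fun t => f (clamp M (W t)))).
  apply: (@bounded_integrable _ _ _ _ _ (`|f 0| + L * M)).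
    apply: (measurableT_comp (f := f \o clamp M)) => //.
    apply: measurableT_comp => //.
    exact: lipschitz_measurable (lipschitz_clamp M0).
  move=> t; have := fL (clamp M (W t)) 0; have /andP[c0 cM] := clamp_itv (W t) M0.
  rewrite subr0 [`|clamp _ _|]ger0_norm// => fc.
  have := ler_normD (f (clamp M (W t)) - f 0) (f 0); rewrite subrK /=.
  have := ler_wpM2l L0 cM; lra.
have E1 : `|\int[Q]_t f (V t) - \int[Q]_t f (clamp M (W t))| <= e / 3.
  apply: (@le_trans _ _ (\int[Q]_t (L * excess M (W t)))).
    apply: Rintegral_dist => // t; rewrite -(dist_clamp (W t) M0); exact: fL.
  by rewrite RintegralZl//; apply: le_trans Leta; rewrite ler_wpM2l.
have := cvg_average_clamp cvgW L0 M0 fL => /cvgrPdist_le avgc.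
near=> n.
have n0 : (0 < n)%N by near: n; exact: nbhs_infty_gt.
have E2 : `|\int[Q]_t f (clamp M (W t)) - average (w n) (f \o clamp M)| <= e / 3.
  by near: n; apply: avgc; lra.
have E3 : `|average (w n) f - average (w n) (f \o clamp M)| <= e / 3.
  apply: (@le_trans _ _ (average (w n) (fun t => L * excess M t))).
    apply: average_dist => // i; rewrite -(dist_clamp (w n i) M0).
    by rewrite max_r ?fL// ltW.
  rewrite /average -mulr_sumr -mulrA; apply: (le_trans _ Leta).
  by rewrite ler_wpM2l// hM.
by have := E1; have := E2; have := E3; rewrite !ler_norml; lra.
Unshelve. all: by end_near. Qed.

End weak_convergence.

(** * The limit of the pressure *)

(** Passing from [t] to [s] multiplies each summand by at most e^{L |s - t|}, since every slope is
    at most [L] in absolute value. *)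
Lemma lipschitz_log_sum_exp (R : realType) (q : nat) (a : R) (B y : 'rV[R]_q) :
  (0 < q)%N -> lipschitz (\sum_(k < q) `|a * y ord0 k|) (log_sum_exp a B y).
Proof.
move=> q0; set L := \sum_(k < q) _.
have half s t : log_sum_exp a B y s <= log_sum_exp a B y t + L * `|s - t|.
  rewrite /log_sum_exp.
  have S0 u := sum_expR_gt0 (fun k => a * y ord0 k * u + B ord0 k) q0.
  rewrite -[X in _ + X]expRK -lnM ?posrE ?expR_gt0//.
  rewrite ler_ln ?posrE ?mulr_gt0 ?expR_gt0// mulr_suml; apply: ler_sum => k _.
  rewrite -expRD ler_expR addrAC lerD2r -lerBlDl -mulrBr.
  apply: le_trans (ler_norm _) _; rewrite normrM ler_wpM2r//.
  by rewrite /L (bigD1 k)//= lerDl sumr_ge0.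
move=> s t; have := half s t; have := half t s.
by rewrite [`|t - s|]distrC ler_norml => ? ?; apply/andP; split; lra.
Qed.

Section pressure_limit.
Context {R : realType} {q : nat} (b m : R) (B : 'rV[R]_q).
Context (w : forall n, 'I_n -> R).
Arguments w : clear implicits.
Hypotheses (b_gt0 : 0 < b) (m_gt0 : 0 < m) (q_gt0 : (0 < q)%N).
Hypothesis w_gt0 : forall n (i : 'I_n), 0 < w n i.
Hypothesis cvg_mean : total_weight (w n) / n%:R @[n --> \oo] --> m.
Hypothesis uniform_tail : forall e : R, 0 < e -> exists2 M : R, 1 <= M &
  forall n, (0 < n)%N -> tail_weight (w n) M / n%:R <= e.
Variable E : 'rV[R]_q -> R.
Hypothesis cvg_E : forall y,
  average (w n) (log_sum_exp (b / m) B y) @[n --> \oo] --> E y.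

Let G y := E y - b / (2 * m) * \sum_(k < q) y ord0 k ^+ 2.
Let phi n := n%:R^-1 * ln (expected_partition b B (w n)).
Let psi n := n%:R^-1 * ln (mean_field_partition_function b B (w n)).
Let b_ge0 : 0 <= b. Proof. exact: ltW. Qed.

Let mean_field_gt0 n : (0 < n)%N -> 0 < mean_field_partition_function b B (w n).
Proof.
move=> n0; have := linearized_partition_le B n0 (@w_gt0 n) b_ge0 m_gt0 q_gt0 0.
by apply: lt_le_trans; exact: expR_gt0.
Qed.

Let expected_gt0 n : (0 < n)%N -> 0 < expected_partition b B (w n).
Proof.
move=> n0.
have h0 : (0 : R) ^+ 2 <= 1 * total_weight (w n).
  by rewrite expr0n/= mul1r ltW// total_weight_gt0.
have := expected_partition_ge B n0 (@w_gt0 n) b_ge0 (lexx 0) ltr01 h0.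
by apply: lt_le_trans; rewrite mulr_gt0 ?expR_gt0 ?mean_field_gt0.
Qed.

Let phi_le_psi n : (0 < n)%N -> phi n <= psi n.
Proof.
move=> n0; rewrite ler_wpM2l ?invr_ge0//.
rewrite ler_ln ?posrE ?expected_gt0 ?mean_field_gt0//; exact: expected_partition_le.
Qed.

Let cvg_inv (C : R) : C / n%:R @[n --> \oo] --> (0 : R).
Proof.
rewrite -(mulr0 C); apply: cvgMl_tmp; rewrite gtr0_cvgV0; [exact: cvgr_idn|].
by near=> n; rewrite ltr0n; near: n; exact: nbhs_infty_gt.
Unshelve. all: by end_near. Qed.

Let psi_le_phi (e : R) : 0 < e -> \forall n \near \oo, psi n - e <= phi n.
Proof.
move=> e0.
(* With l_n <= (m + 1) n, this [eps] and the tail level e / (9 b) make the first two errors of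
   [expected_partition_ge] at most e n / 3 each; the third, b M, does not grow with [n]. *)
pose eps := e / (3 * (b * (1 + b) * (m + 1))).
have b1 : 0 < 1 + b by rewrite addr_gt0.
have m1 : 0 < m + 1 by rewrite addr_gt0.
have eps0 : 0 < eps by rewrite divr_gt0// !mulr_gt0.
have eta0 : 0 < e / (9 * b) by rewrite divr_gt0// mulr_gt0.
have [M M1 hM] := uniform_tail eta0.
near=> n.
have n0 : (0 < n)%N by near: n; exact: nbhs_infty_gt.
have nR : 0 < n%:R :> R by rewrite ltr0n.
have lm1 : total_weight (w n) / n%:R <= m + 1.
  by near: n; apply: (cvgr_le m cvg_mean); rewrite ltrDl.
have lm2 : m / 2 <= total_weight (w n) / n%:R.
  by near: n; apply: (cvgr_ge m cvg_mean); rewrite ltr_pdivrMr// ltr_pMr// ltr1n.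
have hMn : M ^+ 2 / (eps * (m / 2)) / n%:R <= 1.
  by near: n; apply: (cvgr_le 0 (cvg_inv _)).
have bMn : b * M / n%:R <= e / 3.
  by near: n; apply: (cvgr_le 0 (cvg_inv _)); rewrite divr_gt0.
(* Holds eventually because [M] is fixed while l_n >= (m / 2) n. *)
have Ml : M ^+ 2 <= eps * total_weight (w n).
  have c0 : 0 < eps * (m / 2) by rewrite mulr_gt0// divr_gt0.
  have := hMn; rewrite ler_pdivrMr// mul1r ler_pdivrMr//.
  move=> /le_trans; apply; rewrite mulrCA ler_wpM2l ?(ltW eps0)//.
  by rewrite mulrC -ler_pdivlMr.
have M0 : 0 <= M by lra.
have := expected_partition_ge B n0 (@w_gt0 n) b_ge0 M0 eps0 Ml.
set err := (X in expR (- X)) => h.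
have {}h : - err + ln (mean_field_partition_function b B (w n))
    <= ln (expected_partition b B (w n)).
  rewrite -[X in X + _]expRK -lnM ?posrE ?expR_gt0 ?mean_field_gt0//.
  by rewrite ler_ln ?posrE ?mulr_gt0 ?expR_gt0 ?mean_field_gt0 ?expected_gt0.
have errn : err / n%:R <= e.
  have e1 : b * (1 + b) * eps * (total_weight (w n) / n%:R) <= e / 3.
    apply: (@le_trans _ _ (b * (1 + b) * eps * (m + 1))).
      by rewrite ler_wpM2l// (mulr_ge0 (mulr_ge0 b_ge0 (ltW b1)) (ltW eps0)).
    rewrite le_eqVlt; apply/orP; left; apply/eqP; rewrite /eps; field.
    by rewrite !gt_eqF.
  have e2 : 3 * b * (tail_weight (w n) M / n%:R) <= e / 3.
    apply: (@le_trans _ _ (3 * b * (e / (9 * b)))).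
      by rewrite ler_wpM2l ?hM// mulr_ge0.
    by rewrite le_eqVlt; apply/orP; left; apply/eqP; field; rewrite gt_eqF.
  by rewrite /err !mulrDl -!mulrA; rewrite !mulrA in e1 e2 bMn *; lra.
rewrite /psi /phi ![_^-1 * _]mulrC lerBlDr -lerBlDl -mulrBl.
by apply: le_trans errn; rewrite ler_wpM2r ?invr_ge0//; lra.
Unshelve. all: by end_near. Qed.

Let cvg_linearized (y : 'rV[R]_q) :
  linearized_exponent b m B (w n) y / n%:R @[n --> \oo] --> G y.
Proof.
rewrite /linearized_exponent /G.
(* One factor of m^2 cancels against the limit [m] of l_n / n. *)
have -> : b / (2 * m) * \sum_(k < q) y ord0 k ^+ 2 =
    b / (2 * m ^+ 2) * m * \sum_(k < q) y ord0 k ^+ 2.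
  by congr (_ * _); field; rewrite gt_eqF.
under eq_fun do rewrite mulrBl mulrAC -[_ * total_weight _ / _]mulrA.
apply: cvgB; first exact: cvg_E.
by apply: cvgMr_tmp; exact: cvgMl_tmp.
Qed.

Let G_le_phi (y : 'rV[R]_q) (e : R) :
  0 < e -> \forall n \near \oo, G y - e <= phi n.
Proof.
move=> e0; have e2 : 0 < e / 2 by rewrite divr_gt0.
near=> n.
have n0 : (0 < n)%N by near: n; exact: nbhs_infty_gt.
have h1 : G y - e / 2 <= linearized_exponent b m B (w n) y / n%:R.
  by near: n; apply: (cvgr_ge (G y) (@cvg_linearized y)); rewrite ltrBlDr ltrDl.
have h2 : psi n - e / 2 <= phi n by near: n; exact: psi_le_phi.
have h3 : linearized_exponent b m B (w n) y / n%:R <= psi n.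
  rewrite mulrC /psi ler_wpM2l ?invr_ge0// -[leLHS]expRK.
  rewrite ler_ln ?posrE ?expR_gt0 ?mean_field_gt0//.
  exact: linearized_partition_le.
lra.
Unshelve. all: by end_near. Qed.

(** The grid has a number of points independent of [n], so summing over it costs ln(card) / n, which
    vanishes; the rounding cost remains as the term in 1 / N^2. An arbitrary bound [K] on the grid
    is allowed because [G] is not yet known to be bounded. *)
Let phi_le (N : nat) (K e : R) : (0 < N)%N -> 0 < e ->
    (forall tau : {ffun 'I_q -> 'I_N.+1},
      G (\row_k (m * (tau k)%:R / N%:R)) <= K) ->
  \forall n \near \oo, phi n <= K + b * q%:R * (m + 1) / (2 * N%:R ^+ 2) + e.
Proof.
move=> N0 e0 hK; have e2 : 0 < e / 2 by rewrite divr_gt0.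
pose y (tau : {ffun 'I_q -> 'I_N.+1}) : 'rV[R]_q := \row_k (m * (tau k)%:R / N%:R).
have card_gt0 : 0 < #|{: {ffun 'I_q -> 'I_N.+1}}|%:R :> R.
  by rewrite ltr0n; apply/card_gt0P; exists [ffun=> ord0].
have NR : 0 < N%:R :> R by rewrite ltr0n.
near=> n.
have n0 : (0 < n)%N by near: n; exact: nbhs_infty_gt.
have nR : 0 < n%:R :> R by rewrite ltr0n.
have lm1 : total_weight (w n) / n%:R <= m + 1.
  by near: n; apply: (cvgr_le m cvg_mean); rewrite ltrDl.
have h1 : forall tau, linearized_exponent b m B (w n) (y tau) / n%:R <= K + e / 2.
  near: n; apply: filter_forall => tau.
  apply: (cvgr_le (G (y tau)) (@cvg_linearized _)).
  by have := hK tau; rewrite -/(y tau); lra.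
have h2 : ln #|{: {ffun 'I_q -> 'I_N.+1}}|%:R / n%:R <= e / 2.
  by near: n; apply: (cvgr_le 0 (cvg_inv _)).
apply: le_trans (phi_le_psi n0) _.
have := mean_field_partition_le B n0 (@w_gt0 n) b_ge0 m_gt0 q_gt0 N0.
set c := b * q%:R * _ / _ => h.
have {}h : mean_field_partition_function b B (w n) <=
    expR (c + (ln #|{: {ffun 'I_q -> 'I_N.+1}}|%:R + n%:R * (K + e / 2))).
  apply: le_trans h _; rewrite expRD ler_pM2l ?expR_gt0//.
  rewrite expRD lnK ?posrE//.
  apply: (@le_trans _ _
    (\sum_(tau : {ffun 'I_q -> 'I_N.+1}) expR (n%:R * (K + e / 2)))).
    apply: ler_sum => tau _; rewrite ler_expR [leRHS]mulrC -ler_pdivrMr//.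
    exact: h1.
  by rewrite sumr_const [leRHS]mulr_natl.
have {}h : ln (mean_field_partition_function b B (w n)) <=
    c + (ln #|{: {ffun 'I_q -> 'I_N.+1}}|%:R + n%:R * (K + e / 2)).
  by rewrite -[leRHS]expRK ler_ln ?posrE ?expR_gt0 ?mean_field_gt0.
have cn : c / n%:R <= b * q%:R * (m + 1) / (2 * N%:R ^+ 2).
  have -> : c / n%:R = b * q%:R * (total_weight (w n) / n%:R) / (2 * N%:R ^+ 2).
    by rewrite /c; field; rewrite !gt_eqF.
  rewrite ler_wpM2r// ?invr_ge0 ?mulr_ge0 ?exprn_ge0//.
  by rewrite ler_wpM2l// mulr_ge0.
rewrite /psi mulrC.
apply: (@le_trans _ _ ((c +
    (ln #|{: {ffun 'I_q -> 'I_N.+1}}|%:R + n%:R * (K + e / 2))) / n%:R)).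
  by rewrite ler_wpM2r ?invr_ge0.
move: cn h2; clearbody c; set x := ln _ => cn h2.
have -> : (c + (x + n%:R * (K + e / 2))) / n%:R = c / n%:R + x / n%:R + (K + e / 2).
  by field; rewrite gt_eqF.
lra.
Unshelve. all: by end_near. Qed.

(** Boundedness of [G] comes from the pressure itself: eventually G y - 1 <= phi n, while [phi_le]
    with N = 1 bounds [phi n] by a constant not involving [y]. *)
Lemma pressure_has_ubound : has_ubound [set G y | y in [set: 'rV[R]_q]].
Proof.
pose K := \sum_(tau : {ffun 'I_q -> 'I_2})
  `|G (\row_k (m * (tau k)%:R / 1%:R))|.
have hK tau : G (\row_k (m * ((tau : {ffun 'I_q -> 'I_2}) k)%:R / 1%:R)) <= K.
  apply: le_trans (ler_norm _) _.
  by rewrite /K (bigD1 tau)//= lerDl sumr_ge0.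
exists (K + b * q%:R * (m + 1) / (2 * 1%:R ^+ 2) + 1 + 1) => _ [y _ <-].
have : \forall n \near \oo, G y <= K + b * q%:R * (m + 1) / (2 * 1%:R ^+ 2) + 1 + 1.
  near=> n.
  have : G y - 1 <= phi n by near: n; exact: G_le_phi.
  rewrite lerBlDr => /le_trans; apply; rewrite lerD2r.
  by near: n; exact: phi_le.
(* The inequality no longer involves [n], so one index at which it holds is enough. *)
by move=> [n _ /(_ n (leqnn n))].
Unshelve. all: by end_near. Qed.

(** A near-maximizer of [G] gives the lower bound; the upper bound uses that grid values of [G] are
    at most the supremum, with [N] fixed before [n]. *)
Lemma cvg_pressure :
  phi n @[n --> \oo] --> sup [set G y | y in [set: 'rV[R]_q]].
Proof.
set S := [set _ | _ in _].
have hS : has_sup S by split; [exists (G 0), 0|exact: pressure_has_ubound].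
apply/cvgrPdist_le => e e0; have e2 : 0 < e / 2 by rewrite divr_gt0.
have [_ [y _ <-] hy] := sup_adherent e2 hS.
pose X := b * q%:R * (m + 1).
have X0 : 0 <= X by rewrite !mulr_ge0// addr_ge0// ltW.
(* From N >= X / e and N >= 1 follows X <= e N <= e N^2. *)
pose N := (Num.truncn (X / e)).+1.
have XN : X / (2 * N%:R ^+ 2) <= e / 2.
  have N1 : 1 <= N%:R :> R by rewrite ler1n.
  rewrite ler_pdivrMr ?mulr_gt0 ?exprn_gt0 ?ltr0n//.
  have -> : e / 2 * (2 * N%:R ^+ 2) = e * N%:R * N%:R by field.
  apply: (@le_trans _ _ (e * N%:R)).
    by rewrite mulrC -ler_pdivrMr// ltW// truncnS_gt.
  by rewrite ler_peMr// mulr_ge0// ltW.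
near=> n.
have h1 : G y - e / 2 <= phi n by near: n; exact: G_le_phi.
have h2 : phi n <= sup S + X / (2 * N%:R ^+ 2) + e / 2.
  near: n; apply: phi_le => // tau.
  by apply: sup_upper_bound => //; eexists.
by rewrite ler_norml; apply/andP; split; lra.
Unshelve. all: by end_near. Qed.

End pressure_limit.

Theorem theorem1p3 (R : realType)
    (beta : R) (q : nat) (B : 'rV[R]_q)
    (beta_gt0 : 0 < beta) (q_gt0 : (0 < q)%N)
    (B_ge0 : forall k : 'I_q, 0 <= B ord0 k)
    (w : forall n : nat, 'I_n -> R)
    (w_gt0 : forall (n : nat) (i : 'I_n), 0 < w n i)
    (dW : measure_display) (Omega : measurableType dW)
    (Q : probability Omega R) (W : {RV Q >-> R})
    (hW : weight_regularity w W)
    (d : nat -> measure_display) (T : forall n : nat, measurableType (d n))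
    (P : forall n : nat, probability (T n) R)
    (I : forall n : nat, 'I_n -> 'I_n -> {RV (P n) >-> bool})
    (hI : forall n : nat, generalized_random_graph (w n) (I n)) :
  exists phi : R,
    (annealed_pressure beta B (I n) @[n --> \oo] --> phi) /\
    phi%:E = ereal_sup
      [set (F_potts W beta B y
            - (beta' beta / (2 * mean W)
               * \sum_(k < q) y ord0 k ^+ 2)%:E)%E | y in [set: 'rV[R]_q]].
Proof.
have [EW_gt0 cvgW [c [tau [c0 tau2 tailW]]]] := hW.
have small e : 0 < e :> R -> _ := tail_weight_small w_gt0 c0 tau2 tailW (e := e).
have uniform_excess (e : R) : 0 < e -> exists2 M : R, 0 <= M &
    forall n, (0 < n)%N -> average (w n) (excess M) <= e.
  move=> /small[M M1 hM]; have M0 : 0 <= M by lra.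
  exists M => // n n0; apply: le_trans (hM n n0).
  by apply: average_excess_le => // i.
have cvgE := cvg_average_lipschitz w_gt0 cvgW uniform_excess.
(* Applied to the identity, the convergence of averages shows that E[W] is finite and is the limit
   of l_n / n. *)
have id_lip : lipschitz 1 (@id R) by move=> s t; rewrite mul1r.
have [m Em cvg_mean] := cvgE _ _ ler01 id_lip.
have mE : mean W = m by rewrite /mean (_ : 'E_Q[W]%E = m%:E).
have m_gt0 : 0 < m by rewrite -lte_fin -Em.
have b_gt0 : 0 < beta' beta by rewrite subr_gt0 expR_gt1.
have /choice[E EP] : forall y : 'rV[R]_q, exists r : R,
    F_potts W beta B y = r%:E /\
    average (w n) (log_sum_exp (beta' beta / m) B y) @[n --> \oo] --> r.
  move=> y.
  have [r rE rcvg] := cvgE _ _ (sumr_ge0 _ (fun k _ => normr_ge0 _))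
    (lipschitz_log_sum_exp (beta' beta / m) B y q_gt0).
  by exists r; split => //; rewrite -rE /F_potts mE.
have cvg_E y := (EP y).2.
eexists; split.
  have := cvg_pressure b_gt0 m_gt0 q_gt0 w_gt0 cvg_mean small cvg_E.
  apply: cvg_trans; apply: near_eq_cvg; near=> n.
  by rewrite /annealed_pressure (expected_partition_function _ _ (hI n)).
have ub := pressure_has_ubound b_gt0 m_gt0 q_gt0 w_gt0 cvg_mean small cvg_E.
(* All values are finite and the set is nonempty and bounded above, so the extended supremum is the
   real one. *)
rewrite -ereal_sup_EFin//; last by eexists; exists 0.
congr ereal_sup; rewrite image_comp; apply: eq_imagel => y _ /=.
by rewrite (EP y).1 mE EFinB.
Unshelve. all: by end_near. Qed.
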